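(* Let $(M,g)$ be an oriented hyper-Kähler Riemannian four-manifold with parallel self-dual Kähler forms $\Omega^1,\Omega^2,\Omega^3$. The conformal geodesic equations on $(M,g)$ reduce to the Lorentz force equations: a curve with unit tangent vector $u$ and acceleration $a=\nabla_u u$ is a conformal geodesic if and only if $|a|$ is constant along it and there are constants $(c^1,c^2,c^3)$ with $(c^1)^2+(c^2)^2+(c^3)^2=1$ such that $$\nabla_u u=|a|\,J(u)$$ along the curve, where $J$ is the complex structure corresponding to the Kähler form given by the constant self-dual Maxwell field $F=\sum_{j=1}^3c^j\,\Omega^j$.
   Context: The hyper-Kähler structure consists of three parallel two-forms which, in a suitable local oriented orthonormal coframe $(e^1,e^2,e^3,e^4)$, are $\Omega^1=e^1\wedge e^4+e^2\wedge e^3$, $\Omega^2=e^2\wedge e^4+e^3\wedge e^1$, $\Omega^3=e^3\wedge e^4+e^1\wedge e^2$; the orientation is such that these are self-dual. In particular $g$ is Ricci-flat. The complex structure $J$ corresponding to a Kähler form $F$ is defined by $g(X,J(Y))=F(X,Y)$ for all vector fields $X,Y$. $\nabla$ is the Levi-Civita connection. Conformal geodesics: on an $n$-dimensional Riemannian manifold ($n>2$), a curve parametrised by arc-length with unit tangent vector $u$ and acceleration $a=\nabla_u u$ is a conformal geodesic if $$\nabla_u a=-(|a|^2+L(u,u))u+L^\sharp(u),$$ where $L=\frac{1}{n-2}\big(R-\frac{1}{2(n-1)}Sg\big)$ is the Schouten tensor ($R$ the Ricci tensor, $S$ the Ricci scalar), $g(L^\sharp(X),Y)=L(X,Y)$,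 and $|a|^2=g(a,a)$. On a Ricci-flat manifold this reads $\nabla_u a=-|a|^2u$. *)

(* Defs.v *)
From mathcomp Require Import all_boot all_order all_algebra.
From mathcomp Require Import all_classical all_reals all_analysis.

Set Implicit Arguments.
Unset Strict Implicit.
Unset Printing Implicit Defensive.
Import Order.TTheory GRing.Theory Num.Theory.
Import numFieldNormedType.Exports.

Local Open Scope ring_scope.
Local Open Scope classical_set_scope.

(* Vectors of R^n are rows; a covariant 2-tensor with component matrix T
   evaluates to v *m T *m w^T, and an endomorphism acts on the right. *)

Section Smooth.
Context {R : realType} {n : nat}.

Definition partial (V : normedModType R) (i : 'I_n) (f : 'rV[R]_n -> V)
  (x : 'rV[R]_n) : V := 'D_(delta_mx 0 i) f x.

Definition partials (V : normedModType R) (s : seq 'I_n) (f : 'rV[R]_n -> V) :=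
  foldr (@partial V) f s.

(* For U open this is C^oo on U: iterated partial derivatives of every order
   exist and are (Frechet-)differentiable, in particular continuous. *)
Definition smooth_on (V : normedModType R) (U : set 'rV[R]_n)
    (f : 'rV[R]_n -> V) : Prop :=
  forall (s : seq 'I_n) (x : 'rV[R]_n), U x -> differentiable (partials s f) x.

End Smooth.

Definition smooth_curve_on (R : realType) (V : normedModType R) (D : set R)
    (f : R -> V) : Prop :=
  forall (k : nat) (t : R), D t -> derivable (derive1n k f) t 1.

Section Manifold.
Context {R : realType} {n : nat} {M : topologicalType}.

Record chart := Chart {
  cdom : set M;
  cimg : set 'rV[R]_n;
  cmap : M -> 'rV[R]_n;
  cinv : 'rV[R]_n -> M;
  cdom_open : open cdom;
  cimg_open : open cimg;
  cmap_cimg : forall p, cdom p -> cimg (cmap p);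
  cinv_cdom : forall x, cimg x -> cdom (cinv x);
  cmapK : forall p, cdom p -> cinv (cmap p) = p;
  cinvK : forall x, cimg x -> cmap (cinv x) = x;
  cmap_continuous : {in cdom, continuous cmap};
  cinv_continuous : {in cimg, continuous cinv} }.

Definition overlap (phi psi : chart) : set 'rV[R]_n :=
  [set x | cimg phi x /\ cdom psi (cinv phi x)].

Definition transition (phi psi : chart) : 'rV[R]_n -> 'rV[R]_n :=
  cmap psi \o cinv phi.

Record smooth_atlas := SmoothAtlas {
  atlas : set chart;
  atlas_cover : forall p, exists2 phi, atlas phi & cdom phi p;
  atlas_compat : forall phi psi, atlas phi -> atlas psi ->
    smooth_on (overlap phi psi) (transition phi psi) }.

Definition oriented (A : smooth_atlas) : Prop :=
  forall phi psi, atlas A phi -> atlas A psi -> forall x, overlap phi psi x ->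
    0 < \det (jacobian (transition phi psi) x).

(* A smooth covariant 2-tensor field, given by its component matrices in the
   charts of the atlas. *)
Record tensor02 (A : smooth_atlas) := Tensor02 {
  tcomp :> chart -> 'rV[R]_n -> 'M[R]_n;
  tcomp_smooth : forall phi, atlas A phi -> smooth_on (cimg phi) (tcomp phi);
  tcomp_transform : forall phi psi, atlas A phi -> atlas A psi ->
    forall x, overlap phi psi x ->
    tcomp phi x = jacobian (transition phi psi) x
                  *m tcomp psi (transition phi psi x)
                  *m (jacobian (transition phi psi) x)^T }.

Record riemannian_metric (A : smooth_atlas) := RiemannianMetric {
  metric_tensor :> tensor02 A;
  metric_sym : forall phi x, atlas A phi -> cimg phi x ->
    (metric_tensor phi x)^T = metric_tensor phi x;
  metric_pos : forall phi x, atlas A phi -> cimg phi x ->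
    forall v : 'rV[R]_n, v != 0 -> 0 < (v *m metric_tensor phi x *m v^T) 0 0 }.

Record two_form (A : smooth_atlas) := TwoForm {
  form_tensor :> tensor02 A;
  form_alt : forall phi x, atlas A phi -> cimg phi x ->
    (form_tensor phi x)^T = - form_tensor phi x }.

Section Geometry.
Variables (A : smooth_atlas) (g : riemannian_metric A).
Implicit Types (phi : chart) (x v w : 'rV[R]_n) (i j k l : 'I_n).

Definition inner phi x v w : R := (v *m g phi x *m w^T) 0 0.

Definition gnorm phi x v : R := Num.sqrt (inner phi x v v).

Definition ginv phi x : 'M[R]_n := invmx (g phi x).

Definition christoffel phi k i j x : R :=
  2^-1 * \sum_l ginv phi x k l *
    (partial i (fun y => g phi y j l) x + partial j (fun y => g phi y i l) x
     - partial l (fun y => g phi y i j) x).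

(* dx^k (Riem(d_i, d_j) d_l),
   with Riem(X, Y) = [nabla_X, nabla_Y] - nabla_[X, Y] *)
Definition riemann phi k l i j x : R :=
  partial i (christoffel phi k j l) x - partial j (christoffel phi k i l) x
  + \sum_m (christoffel phi k i m x * christoffel phi m j l x
            - christoffel phi k j m x * christoffel phi m i l x).

Definition ricci phi x : 'M[R]_n :=
  \matrix_(l, j) \sum_k riemann phi k l k j x.

Definition scalar_curvature phi x : R :=
  \sum_i \sum_j ginv phi x i j * ricci phi x i j.

Definition schouten phi x : 'M[R]_n :=
  (n%:R - 2)^-1 *:
    (ricci phi x - (scalar_curvature phi x / (2 * (n%:R - 1))) *: g phi x).

(* T^# for a covariant 2-tensor T: g(T^#(v), w) = T(v, w), see [sharpP]. *)
Definition sharp phi x (T : 'M[R]_n) v : 'rV[R]_n := v *m T *m ginv phi x.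

(* The endomorphism J with g(v, J(w)) = F(v, w), see [endo_of_formP]. *)
Definition endo_of_form phi x (F : 'M[R]_n) w : 'rV[R]_n :=
  w *m F^T *m ginv phi x.

Lemma metric_unit phi x : atlas A phi -> cimg phi x -> g phi x \in unitmx.
Proof.
move=> Aphi xphi; rewrite -row_free_unit; apply/negPn/negP => nfree.
have [v vg0 v0] : exists2 v : 'rV[R]_n, v *m g phi x = 0 & v != 0.
  have : kermx (g phi x) != 0 by rewrite kermx_eq0.
  by case/rowV0Pn => v /sub_kermxP vg0 v0; exists v.
by have := metric_pos g Aphi xphi v0; rewrite vg0 mul0mx mxE ltxx.
Qed.

Lemma sharpP phi x T v w : atlas A phi -> cimg phi x ->
  inner phi x (sharp phi x T v) w = (v *m T *m w^T) 0 0.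
Proof.
by move=> Aphi xphi; rewrite /inner /sharp mulmxKV// metric_unit.
Qed.

Lemma endo_of_formP phi x F v w : atlas A phi -> cimg phi x ->
  inner phi x v (endo_of_form phi x F w) = (v *m F *m w^T) 0 0.
Proof.
move=> Aphi xphi; rewrite /inner /endo_of_form !trmx_mul trmxK trmx_inv.
by rewrite metric_sym// -!mulmxA mulKVmx// metric_unit.
Qed.

(* nabla T = 0 *)
Definition parallel (T : tensor02 A) : Prop :=
  forall phi x, atlas A phi -> cimg phi x -> forall k i j,
    partial k (fun y => T phi y i j) x
    - \sum_l christoffel phi l k i x * T phi x l j
    - \sum_l christoffel phi l k j x * T phi x i l = 0.

Section Curve.
Variables (I : set R) (gamma : R -> M).

Definition smooth_curve : Prop :=
  {in I, continuous gamma} /\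
  forall phi, atlas A phi ->
    smooth_curve_on (I `&` gamma @^-1` cdom phi) (cmap phi \o gamma).

(* P holds at all parameters, in all charts of the atlas around the point *)
Definition along (P : chart -> R -> Prop) : Prop :=
  forall t, I t -> forall phi, atlas A phi -> cdom phi (gamma t) -> P phi t.

Definition velocity phi : R -> 'rV[R]_n := derive1 (cmap phi \o gamma).

(* nabla_u W, for a vector field W along gamma given by its components *)
Definition cov_derivative phi (W : R -> 'rV[R]_n) (t : R) : 'rV[R]_n :=
  derive1 W t + \row_k \sum_i \sum_j
    christoffel phi k i j (cmap phi (gamma t)) * velocity phi t 0 i * W t 0 j.

Definition acceleration phi : R -> 'rV[R]_n :=
  cov_derivative phi (velocity phi).

Definition unit_speed : Prop :=
  along (fun phi t =>
    gnorm phi (cmap phi (gamma t)) (velocity phi t) = 1).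

Definition conformal_geodesic : Prop :=
  along (fun phi t =>
    let x := cmap phi (gamma t) in
    let u := velocity phi t in
    let a := acceleration phi t in
    let L := schouten phi x in
    cov_derivative phi (acceleration phi) t =
      - (gnorm phi x a ^+ 2 + (u *m L *m u^T) 0 0) *: u + sharp phi x L u).

Definition constant_acceleration_norm : Prop :=
  exists r : R, along (fun phi t =>
    gnorm phi (cmap phi (gamma t)) (acceleration phi t) = r).

(* nabla_u u = |a| J(u), with g(X, J(Y)) = F(X, Y) *)
Definition lorentz_force (F : chart -> 'rV[R]_n -> 'M[R]_n) : Prop :=
  along (fun phi t =>
    let x := cmap phi (gamma t) in
    let a := acceleration phi t in
    a = gnorm phi x a *: endo_of_form phi x (F phi x) (velocity phi t)).

End Curve.
End Geometry.
End Manifold.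

Arguments chart R n M : clear implicits.
Arguments smooth_atlas R n M : clear implicits.

(* Normalised so that (a /\ b)(X, Y) = a(X) b(Y) - a(Y) b(X). *)
Definition wedge (R : realType) (n : nat) (a b : 'rV[R]_n) : 'M[R]_n :=
  a^T *m b - b^T *m a.

Section HyperKahler.
Context {R : realType} {M : topologicalType}.
Variables (A : smooth_atlas R 4 M) (g : riemannian_metric A).

(* The rows of e are the coframe (e^1, e^2, e^3, e^4), and Omega below is
   (Omega^1, Omega^2, Omega^3), both indexed from 0. *)
Definition oriented_orthonormal_coframe (phi : chart R 4 M)
    (U : set 'rV[R]_4) (e : 'rV[R]_4 -> 'M[R]_4) : Prop :=
  smooth_on U e /\
  forall x, U x -> g phi x = (e x)^T *m e x /\ 0 < \det (e x).

Definition standard_form (e : 'M[R]_4) (j : 'I_3) : 'M[R]_4 :=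
  let e1 := row (@Ordinal 4 0 isT) e in
  let e2 := row (@Ordinal 4 1 isT) e in
  let e3 := row (@Ordinal 4 2 isT) e in
  let e4 := row (@Ordinal 4 3 isT) e in
  match nat_of_ord j with
  | 0%N => wedge e1 e4 + wedge e2 e3
  | 1%N => wedge e2 e4 + wedge e3 e1
  | _ => wedge e3 e4 + wedge e1 e2
  end.

Definition hyper_kahler (Omega : 'I_3 -> two_form A) : Prop :=
  (forall j, parallel g (Omega j)) /\
  forall phi x, atlas A phi -> cimg phi x ->
    exists (U : set 'rV[R]_4) (e : 'rV[R]_4 -> 'M[R]_4),
      [/\ open_nbhs x U, U `<=` cimg phi,
          oriented_orthonormal_coframe phi U e &
          forall y, U y -> forall j, Omega j phi y = standard_form (e y) j].

End HyperKahler.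

(* Main.v *)
(* A hyper-Kaehler metric is Ricci-flat: by the symmetry of second derivatives
   the curvature annihilates the parallel forms Omega^j, hence is traceless and
   commutes with the quaternionic endomorphisms Omega^i (Omega^j)^-1; the
   Bianchi identity then makes Ric and all its products with these
   endomorphisms symmetric, which forces Ric = 0.  So the conformal geodesic
   equation is nabla_u a = -|a|^2 u.

   If it holds, then g(u, a) = 0 because |u| = 1, and |a|^2 and the three
   numbers Omega^j(a, u) have zero derivative, by antisymmetry of Omega^j.
   Since u, J_1 u, J_2 u, J_3 u is an orthonormal basis,
   a = sum_j Omega^j(a, u) J_j u, so c^j = Omega^j(a, u) / |a| works when
   a <> 0.  Conversely J is parallel and J^2 = -1, so a = r J u with r constant
   gives nabla_u a = r J a = -r^2 u.

   These scalars are differentiated in one chart at a time; to conclude that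
   they are constant on the interval one needs that the acceleration, as
   computed from the Christoffel symbols, is a vector independent of the
   chart. *)

From HB Require Import structures.
Require Import Defs.
From mathcomp Require Import all_boot all_order all_algebra.
From mathcomp Require Import all_classical all_reals all_analysis.
From mathcomp Require Import ring lra.

Set Implicit Arguments.
Unset Strict Implicit.
Unset Printing Implicit Defensive.
Import Order.TTheory GRing.Theory Num.Theory.
Import numFieldNormedType.Exports.
Local Open Scope ring_scope.
Local Open Scope classical_set_scope.

(** * Derivatives of matrix-valued functions *)

Section MatrixCalculus.
Context {R : realType} {V : normedModType R}.
Implicit Types (x v : V) (m n p : nat).

Lemma is_derive_mxP m n (M : V -> 'M[R]_(m, n)) x v dM :
  is_derive x v M dM <->
  forall i j, is_derive x v (fun y => M y i j) (dM i j).
Proof.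
split=> [[dvM <-] i j|dMij].
  by apply: DeriveDef; [move/derivable_mxP: dvM; exact | rewrite derive_mx// mxE].
have dvM : derivable M x v by apply/derivable_mxP => i j; case: (dMij i j).
apply: DeriveDef => //; rewrite derive_mx//.
by apply/matrixP => i j; rewrite mxE; case: (dMij i j).
Qed.

Lemma derive_coord m n (M : V -> 'M[R]_(m, n)) x v i j :
  derivable M x v -> 'D_v (fun y => M y i j) x = ('D_v M x) i j.
Proof. by move=> dM; rewrite derive_mx// mxE. Qed.

Lemma is_derive_trmx m n (M : V -> 'M[R]_(m, n)) x v dM :
  is_derive x v M dM -> is_derive x v (fun y => (M y)^T) dM^T.
Proof.
move=> /is_derive_mxP dMij; apply/is_derive_mxP => i j; rewrite mxE.
have -> : (fun y => (M y)^T i j) = (fun y => M y j i).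
  by apply/funext => y; rewrite mxE.
exact: dMij.
Qed.

Lemma is_derive_mulmx m n p (M : V -> 'M[R]_(m, n)) (N : V -> 'M[R]_(n, p))
    x v dM dN : is_derive x v M dM -> is_derive x v N dN ->
  is_derive x v (fun y => M y *m N y) (dM *m N x + M x *m dN).
Proof.
move=> /is_derive_mxP dMij /is_derive_mxP dNij; apply/is_derive_mxP => i j.
have -> : (fun y => (M y *m N y) i j) =
    \sum_k ((fun y => M y i k) * (fun y => N y k j)).
  by apply/funext => y; rewrite mxE fct_sumE.
rewrite !mxE -big_split/=; apply: is_derive_eq.
by apply: eq_bigr => k _; rewrite addrC; congr (_ + _); rewrite mulrC.
Qed.

Lemma differentiable_mxP m n (M : V -> 'M[R]_(m, n)) x :
  differentiable M x <-> forall i j, differentiable (fun y => M y i j) x.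
Proof.
split=> [dM i j|dM].
  have -> : (fun y => M y i j) = (fun N : 'M[R]_(m, n) => N i j : R) \o M by [].
  by apply: differentiable_comp => //; exact: differentiable_coord.
have -> : M = \sum_i \sum_j (fun y => M y i j *: delta_mx i j).
  apply/funext => y; rewrite fct_sumE [LHS]matrix_sum_delta.
  by apply: eq_bigr => i _; rewrite fct_sumE.
apply: differentiable_sum => i; apply: differentiable_sum => j.
exact: differentiableZl.
Qed.

Lemma differentiable_mulmx m n p (M : V -> 'M[R]_(m, n)) (N : V -> 'M[R]_(n, p))
    x : differentiable M x -> differentiable N x ->
  differentiable (fun y => M y *m N y) x.
Proof.
move=> /differentiable_mxP dM /differentiable_mxP dN.
apply/differentiable_mxP => i j.
have -> : (fun y => (M y *m N y) i j) =
    \sum_k ((fun y => M y i k) * (fun y => N y k j)).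
  by apply/funext => y; rewrite mxE fct_sumE.
by apply: differentiable_sum => k; exact: differentiableM.
Qed.

Lemma differentiable_prod (I : Type) (s : seq I) (f : I -> V -> R) x :
  (forall i, differentiable (f i) x) ->
  differentiable (fun y => \prod_(i <- s) f i y) x.
Proof.
move=> df; elim: s => [|i s IHs].
  by under eq_fun do rewrite big_nil; exact: differentiable_cst.
by under eq_fun do rewrite big_cons; exact: differentiableM.
Qed.

Lemma differentiable_bigsum (I : Type) (s : seq I) (f : I -> V -> R) x :
  (forall i, differentiable (f i) x) ->
  differentiable (fun y => \sum_(i <- s) f i y) x.
Proof.
move=> df; elim: s => [|i s IHs].
  by under eq_fun do rewrite big_nil; exact: differentiable_cst.
by under eq_fun do rewrite big_cons; exact: differentiableD.
Qed.

Lemma differentiable_det n (M : V -> 'M[R]_n) x :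
  differentiable M x -> differentiable (fun y => \det (M y)) x.
Proof.
move=> /differentiable_mxP dM; apply: differentiable_bigsum => s.
apply: differentiableM; first exact: differentiable_cst.
exact: differentiable_prod.
Qed.


Lemma near_shift0 (P : set V) x :
  (\forall y \near x, P y) -> \forall y \near 0, P (y + x).
Proof.
move=> Px; rewrite (near_shift x).
by near=> y; rewrite /= sub0r subrK; near: y.
Unshelve. all: by end_near. Qed.

(** The first-order expansion of [f] at [x] only involves values near [x], so the differential of
    [f] also serves for [g]. *)
Lemma near_eq_differentiable (W : normedModType R) (f g : V -> W) x :
  (\near x, f x = g x) -> differentiable f x -> differentiable g x.
Proof.
move=> fg df; have [dfc] := (diff_locallyP _ _).1 df.
have fgx : f x = g x by exact: nbhs_singleton fg.
move=> /eqaddoP fo.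
have go : g \o shift x = cst (g x) + 'd f x +o_ 0 id.
  apply/eqaddoP => e e0; have := fo e e0.
  have fg0 : \forall y \near 0, f (y + x) = g (y + x) by exact: (near_shift0 fg).
  by apply: filterS2 fg0 => y /= fgy; rewrite !fctE /= fgy fgx.
by apply/diff_locallyP; rewrite (diff_unique dfc go).
Qed.

(** Near [x] the inverse is the adjugate divided by the determinant, and both are polynomial in the
    entries. *)
Lemma differentiable_invmx n (M : V -> 'M[R]_n) x :
  differentiable M x -> (\forall y \near x, M y \in unitmx) ->
  differentiable (fun y => invmx (M y)) x.
Proof.
move=> dM uM; apply: (@near_eq_differentiable _
  (fun y => (\det (M y))^-1 *: \adj (M y))).
  by apply: filterS uM => y uMy; rewrite /invmx uMy.
have det0 : \det (M x) != 0 by rewrite -unitfE; exact: nbhs_singleton uM.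
apply/differentiable_mxP => i j.
have -> : (fun y => ((\det (M y))^-1 *: \adj (M y)) i j) =
    (fun y => (\det (M y))^-1) * (fun y => cofactor (M y) j i).
  by apply/funext => y; rewrite !mxE.
apply: differentiableM.
  by apply: differentiableV => //; exact: differentiable_det.
apply: differentiableM; first exact: differentiable_cst.
apply: differentiable_det; apply/differentiable_mxP => k l.
under eq_fun do rewrite !mxE.
exact: (differentiable_mxP _ _).1.
Qed.

(** * Symmetry of second derivatives *)

(** The mean value theorem along [v] turns the second difference into [h] times an increment of
    [F = 'D_v f] in the direction [h *: w]; the differential of [F] at [x] gives that increment up
    to o(h). *)
Lemma second_difference (f : V -> R) x v w :
  (\forall y \near x, derivable f y v) -> differentiable ('D_v f) x ->
  forall e, 0 < e -> \forall h \near 0^'+,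
  `|f (x + h *: v + h *: w) - f (x + h *: v) - f (x + h *: w) + f x
    - h ^+ 2 * 'D_w ('D_v f) x| <= e * h ^+ 2.
Proof.
move=> fv dF e e0; set F := 'D_v f.
(* The remainders at [s *: v + h *: w] and at [s *: v] add up to at most e / C times h (2 |v| +
   |w|), which this [C] keeps below [e * h]; the [+ 1] makes [C] positive even when both vectors
   vanish. *)
pose C := 2 * `|v| + `|w| + 1.
have C0 : 0 < C by rewrite ltr_wpDl// addr_ge0// mulr_ge0.
have eC0 : 0 < e / C by exact: divr_gt0.
have [dFc] := (diff_locallyP _ _).1 dF.
move=> /eqaddoP /(_ _ eC0) /= Fo.
have fv0 : \forall y \near 0, derivable f (y + x) v.
  exact: (near_shift0 fv).
have [d d0 Hd] := (nbhs_ballP _ _).1 (filterI Fo fv0).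
have {}Hd k : `|k| < d -> `|F (k + x) - F x - 'd F x k| <= e / C * `|k|
    /\ derivable f (k + x) v.
  move=> kd; have [|A1 A2] := Hd k; first by rewrite -ball_normE /= sub0r normrN.
  by split=> //; move: A1; rewrite !fctE /= opprD addrA.
near=> h.
have h0 : 0 < h by [].
have hd : h * C < d.
  rewrite -ltr_pdivlMr//; near: h.
  exact: nbhs_right_lt (divr_gt0 d0 C0).
have b1 s : 0 <= s <= h -> `|s *: v + h *: w| <= h * (`|v| + `|w|).
  move=> /andP[s0 sh]; rewrite (le_trans (ler_normD _ _))// !normrZ mulrDr.
  by rewrite !ger0_norm ?(ltW h0)// lerD// ler_wpM2r.
have b2 s : 0 <= s <= h -> `|s *: v| <= h * `|v|.
  by move=> /andP[s0 sh]; rewrite normrZ ger0_norm// ler_wpM2r.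
have c1 : h * (`|v| + `|w|) < d.
  by apply: le_lt_trans hd; rewrite ler_pM2l// /C; have := normr_ge0 v; lra.
have c2 : h * `|v| < d.
  apply: le_lt_trans c1; rewrite ler_pM2l//; have := normr_ge0 w; lra.
(* The second difference is [phi h - phi 0]. *)
pose phi s := f (s *: v + (h *: w + x)) - f (s *: v + x).
pose dphi s := F (s *: v + (h *: w + x)) - F (s *: v + x).
have dline y s : derivable f (s *: v + y) v ->
    is_derive s 1 (fun s => f (s *: v + y)) (F (s *: v + y)).
  move=> dfs; have eqg :
      (fun h : R => h^-1 *: (f ((h *: 1 + s) *: v + y) - f (s *: v + y))) =
      (fun h => h^-1 *: (f (h *: v + (s *: v + y)) - f (s *: v + y))).
    by apply/funext => r; rewrite [r *: 1]mulr1 scalerDl addrA.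
  by apply: DeriveDef; rewrite /derivable /derive /= eqg.
have dphiP s : 0 <= s <= h -> is_derive s 1 phi (dphi s).
  move=> sh; apply: is_deriveB; apply: dline.
    by rewrite addrA; apply: (Hd _ _).2; exact: le_lt_trans (b1 _ sh) c1.
  by apply: (Hd _ _).2; exact: le_lt_trans (b2 _ sh) c2.
have [||s] := @MVT R phi dphi 0 h h0.
- by move=> s /[!in_itv]/= /andP[s0 sh]; apply: dphiP; rewrite !ltW.
- apply: derivable_within_continuous => s; rewrite in_itv/= => sh.
  by have [] := dphiP s sh.
rewrite in_itv/= subr0 => /andP[/ltW s0 /ltW sh].
have {s0 sh}sh : 0 <= s <= h by rewrite s0 sh.
rewrite /phi scale0r !add0r => Dphi.
have [k1 _] := Hd _ (le_lt_trans (b1 _ sh) c1).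
have [k2 _] := Hd _ (le_lt_trans (b2 _ sh) c2).
have dFh : 'd F x (s *: v + h *: w) - 'd F x (s *: v) = h * 'd F x w.
  by rewrite linearD/= addrAC subrr add0r linearZ.
have -> : f (x + h *: v + h *: w) - f (x + h *: v) - f (x + h *: w) + f x
    - h ^+ 2 * 'D_w F x = h * (dphi s - h * 'D_w F x).
  rewrite mulrBr mulrA -expr2; congr (_ - _); rewrite mulrC -Dphi.
  rewrite [h *: v + x]addrC [h *: w + x]addrC [h *: v + _]addrC -!addrA.
  rewrite [h *: w + h *: v]addrC; ring.
rewrite deriveE// -dFh normrM gtr0_norm// expr2 [e * _]mulrCA ler_pM2l//.
have -> : dphi s - ('d F x (s *: v + h *: w) - 'd F x (s *: v)) =
   (F (s *: v + h *: w + x) - F x - 'd F x (s *: v + h *: w))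
   - (F (s *: v + x) - F x - 'd F x (s *: v)).
  rewrite /dphi -[s *: v + h *: w + x]addrA; ring.
apply: (le_trans (ler_normB _ _)).
apply: (le_trans (lerD k1 k2)).
rewrite -mulrDr mulrAC ler_pdivrMr// -mulrA ler_pM2l//.
apply: (le_trans (lerD (b1 _ sh) (b2 _ sh))).
rewrite -mulrDr ler_pM2l// /C; lra.
Unshelve. all: by end_near. Qed.

(** The second difference is symmetric in [v] and [w]. Divided by [h ^+ 2] it lies within [e / 2] of
    either mixed derivative, so these differ by at most an arbitrary [e]. *)
Lemma derive_comm_real (f : V -> R) x v w :
  (\forall y \near x, derivable f y v) -> (\forall y \near x, derivable f y w) ->
  differentiable ('D_v f) x -> differentiable ('D_w f) x ->
  'D_w ('D_v f) x = 'D_v ('D_w f) x.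
Proof.
move=> fv fw dv dw; apply/eqP; rewrite -subr_eq0 -normr_le0.
apply/ler_addgt0Pr => e e0; rewrite add0r.
have e20 : 0 < e / 2 by exact: divr_gt0.
have Hv := second_difference w fv dv e20.
have Hw := second_difference v fw dw e20.
have h00 : \forall h \near 0^'+, 0 < h :> R by exact: nbhs_right_gt.
have [h [[h0 H1] H2]] := @filter_ex R (0^'+) _ _ (filterI (filterI h00 Hv) Hw).
have h20 : 0 < h ^+ 2 by exact: exprn_gt0.
rewrite -(ler_pM2r h20) -[in leLHS](gtr0_norm h20) -normrM.
rewrite (addrAC x) in H2.
move: H1 H2; set A := f _ - _ - _ + _; set B := f _ - _ - _ + _.
have -> : B = A by rewrite /A /B -!addrA; congr (_ + _); rewrite addrCA.
set a := 'D_w _ x; set b := 'D_v _ x => H1 H2.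
have -> : (a - b) * h ^+ 2 = (A - h ^+ 2 * b) - (A - h ^+ 2 * a) by ring.
apply: (le_trans (ler_normB _ _)); apply: (le_trans (lerD H2 H1)).
by rewrite -mulrDl -splitr.
Qed.

Lemma derive_comm m n (f : V -> 'M[R]_(m, n)) x v w :
  (\forall y \near x, differentiable f y) ->
  differentiable ('D_v f) x -> differentiable ('D_w f) x ->
  'D_w ('D_v f) x = 'D_v ('D_w f) x.
Proof.
move=> df dv dw; apply/matrixP => i j.
have dvw : derivable ('D_v f) x w by exact: diff_derivable.
have dwv : derivable ('D_w f) x v by exact: diff_derivable.
apply: etrans (esym (derive_coord i j dvw)) (etrans _ (derive_coord i j dwv)).
have E u : \forall y \near x, 'D_u f y i j = 'D_u (fun z => f z i j) y.
  apply: filterS df => y dfy; exact/esym/derive_coord/diff_derivable.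
have dij u : \forall y \near x, derivable (fun z => f z i j) y u.
  apply: filterS df => y dfy; apply: (derivable_mxP _ _ _).1.
  exact: diff_derivable.
apply: etrans (near_eq_derive _ (E v)) _.
apply: etrans _ (esym (near_eq_derive _ (E w))).
have dE u : differentiable ('D_u f) x -> differentiable ('D_u (fun z => f z i j)) x.
  move=> du; apply: near_eq_differentiable (E u) _.
  exact: (differentiable_mxP _ _).1 du i j.
exact: derive_comm_real (dij v) (dij w) (dE _ dv) (dE _ dw).
Qed.

End MatrixCalculus.

(* [partial] and [derive1] are sealed: when two derivatives differ, the
   unifier would otherwise unfold them down to their limits. *)
HB.lock Definition pderiv (R : realType) (n : nat) (W : normedModType R)
    (i : 'I_n) (f : 'rV[R]_n -> W) (x : 'rV[R]_n) : W := partial i f x.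

HB.lock Definition tderiv (R : realType) (W : normedModType R)
    (f : R -> W) (t : R) : W := derive1 f t.

(** * Partial derivatives and the chain rule in coordinates *)

Section ChainRule.
Context {R : realType} {n : nat}.

Lemma partialE (W : normedModType R) i (f : 'rV[R]_n -> W) x :
  partial i f x = pderiv i f x.
Proof. by rewrite pderiv.unlock. Qed.

Lemma is_derive_pderiv (W : normedModType R) i (f : 'rV[R]_n -> W) x :
  differentiable f x -> is_derive x (delta_mx 0 i) f (pderiv i f x).
Proof. by rewrite pderiv.unlock => df; exact/derivableP/diff_derivable. Qed.

Lemma pderiv_eq (W : normedModType R) i (f : 'rV[R]_n -> W) x df :
  is_derive x (delta_mx 0 i) f df -> pderiv i f x = df.
Proof. by rewrite pderiv.unlock; case. Qed.

Lemma near_eq_pderiv (W : normedModType R) i (f h : 'rV[R]_n -> W) x :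
  (\forall y \near x, f y = h y) -> pderiv i f x = pderiv i h x.
Proof. rewrite pderiv.unlock; exact: near_eq_derive. Qed.

Lemma pderiv_coord p q i (f : 'rV[R]_n -> 'M[R]_(p, q)) x j k :
  differentiable f x -> pderiv i (fun y => f y j k) x = pderiv i f x j k.
Proof. by rewrite pderiv.unlock => df; exact/derive_coord/diff_derivable. Qed.

Lemma pderiv_comm p q i j (f : 'rV[R]_n -> 'M[R]_(p, q)) x :
  (\forall y \near x, differentiable f y) ->
  differentiable (pderiv i f) x -> differentiable (pderiv j f) x ->
  pderiv j (pderiv i f) x = pderiv i (pderiv j f) x.
Proof. rewrite pderiv.unlock; exact: derive_comm. Qed.

Lemma is_derive_tderiv (W : normedModType R) (f : R -> W) (t : R) :
  derivable f t 1 -> is_derive t 1 f (tderiv f t).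
Proof. by rewrite tderiv.unlock derive1E => df; exact/derivableP. Qed.

Lemma tderiv_eq (W : normedModType R) (f : R -> W) (t : R) df :
  is_derive t 1 f df -> tderiv f t = df.
Proof. by rewrite tderiv.unlock derive1E; case. Qed.

Lemma diff_rV_sum (W : normedModType R) (f : 'rV[R]_n -> W) x v :
  differentiable f x -> 'd f x v = \sum_i v 0 i *: pderiv i f x.
Proof.
move=> df; rewrite [in LHS](row_sum_delta v) linear_sum/=.
by apply: eq_bigr => i _; rewrite linearZ/= pderiv.unlock /partial deriveE.
Qed.

Lemma is_derive_comp_rV (U W : normedModType R) (h : U -> 'rV[R]_n)
    (f : 'rV[R]_n -> W) x v dh :
  differentiable h x -> is_derive x v h dh -> differentiable f (h x) ->
  is_derive x v (f \o h) (\sum_i dh 0 i *: pderiv i f (h x)).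
Proof.
move=> hx [_ <-] df.
have dfh : differentiable (f \o h) x by exact: differentiable_comp.
apply: DeriveDef; first exact: diff_derivable.
by rewrite deriveE// diff_comp//= diff_rV_sum// -deriveE.
Qed.

End ChainRule.

(** * Constancy on intervals, small index sets, inverses of products *)

Lemma derive0_interval_cst (R : realType) (I : set R) (f : R -> R) :
  is_interval I -> (forall t, I t -> is_derive t 1 f 0) ->
  forall s t, I s -> I t -> f s = f t.
Proof.
move=> itvI df; suff lef s t : I s -> I t -> s < t -> f s = f t.
  move=> s t Is It; case: (ltgtP s t) => [|st|->//]; first exact: lef.
  by rewrite (lef t s).
move=> Is It st.
have Ist r : r \in `[s, t]%R -> I r.
  by rewrite in_itv/= => ?; exact: itvI Is It _ _.
have [||c _] := @MVT R f (cst 0) s t st.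
- by move=> r rst; apply: df; apply: Ist; exact: subset_itv_oo_cc rst.
- apply: derivable_within_continuous => r rst.
  by have [] := df r (Ist _ rst).
by rewrite mul0r => /eqP; rewrite subr_eq0 => /eqP.
Qed.

(** The cases use the literal ordinals of [standard_form], so that they match it syntactically after
    the case split. *)
Lemma ord3P (P : 'I_3 -> Prop) :
  P (@Ordinal 3 0 isT) -> P (@Ordinal 3 1 isT) -> P (@Ordinal 3 2 isT) ->
  forall i, P i.
Proof.
move=> P0 P1 P2 [[|[|[|i]]] i3] //.
- by rewrite (bool_irrelevance i3 isT).
- by rewrite (bool_irrelevance i3 isT).
- by rewrite (bool_irrelevance i3 isT).
Qed.

Lemma ord4P (P : 'I_4 -> Prop) :
  P (@Ordinal 4 0 isT) -> P (@Ordinal 4 1 isT) -> P (@Ordinal 4 2 isT) ->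
  P (@Ordinal 4 3 isT) -> forall i, P i.
Proof.
move=> P0 P1 P2 P3 [[|[|[|[|i]]]] i4] //.
- by rewrite (bool_irrelevance i4 isT).
- by rewrite (bool_irrelevance i4 isT).
- by rewrite (bool_irrelevance i4 isT).
- by rewrite (bool_irrelevance i4 isT).
Qed.

Lemma sum_ord3 (V : nmodType) (F : 'I_3 -> V) :
  \sum_i F i = F (@Ordinal 3 0 isT) + F (@Ordinal 3 1 isT) + F (@Ordinal 3 2 isT).
Proof.
rewrite !big_ord_recr big_ord0/= add0r.
by do !congr (_ + _); congr F; apply: val_inj.
Qed.

Lemma sum_ord4 (V : nmodType) (F : 'I_4 -> V) :
  \sum_i F i = F (@Ordinal 4 0 isT) + F (@Ordinal 4 1 isT)
               + F (@Ordinal 4 2 isT) + F (@Ordinal 4 3 isT).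
Proof.
rewrite !big_ord_recr big_ord0/= add0r.
by do !congr (_ + _); congr F; apply: val_inj.
Qed.

Lemma invmx_mul (R : comUnitRingType) (n : nat) (A B : 'M[R]_n) :
  A \in unitmx -> B \in unitmx -> invmx (A *m B) = invmx B *m invmx A.
Proof.
move=> AU BU; have ABU : A *m B \in unitmx by rewrite unitmx_mul AU.
apply: (can_inj (mulKmx ABU)).
by rewrite mulmxV// mulmxA mulmxK// mulmxV.
Qed.

(** * The forms of an orthonormal coframe *)

Section Quaternions.
Context {R : realType}.
Implicit Types (e : 'M[R]_4) (c : 'I_3 -> R) (u v : 'rV[R]_4).

Local Notation q := (standard_form (1%:M : 'M[R]_4)).

(** Wedge products are natural under pull-back: [e] carries the constant forms [q] of the standard
    coframe of R^4 to the given ones. This reduces the algebra below to explicit matrices. *)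
Lemma standard_formE e j : standard_form e j = e^T *m q j *m e.
Proof.
have wedgeE (a b : 'I_4) : wedge (row a e) (row b e) =
    e^T *m wedge (row a 1%:M) (row b (1%:M : 'M[R]_4)) *m e.
  by rewrite /wedge !row1 !rowE !trmx_mul mulmxBr mulmxBl !mulmxA.
elim/ord3P: j; rewrite /standard_form/= !wedgeE -mulmxDl -mulmxDr; reflexivity.
Qed.

Lemma standard_form1E j (i k : 'I_4) : q j i k =
  let d a b : R := (i == a :> nat)%:R * (k == b :> nat)%:R
                   - (i == b :> nat)%:R * (k == a :> nat)%:R in
  match nat_of_ord j with
  | 0 => d 0%N 3%N + d 1%N 2%N
  | 1 => d 1%N 3%N + d 2%N 0%N
  | _ => d 2%N 3%N + d 0%N 1%N
  end.
Proof.
have wedgeE (a b : 'I_4) : wedge (row a 1%:M) (row b (1%:M : 'M[R]_4)) i k =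
    (i == a :> nat)%:R * (k == b :> nat)%:R
    - (i == b :> nat)%:R * (k == a :> nat)%:R.
  by rewrite !mxE !big_ord1 !mxE !(eq_sym a) !(eq_sym b).
by elim/ord3P: j; rewrite /standard_form/= mxE !wedgeE.
Qed.

Lemma standard_form1_tr j : (q j)^T = - q j.
Proof.
(* The forms are made opaque and only their Kronecker-delta entries are kept, which leaves
   polynomial identities for [ring]. The same device recurs in the next lemmas. *)
apply/matrixP => i k; have := @standard_form1E; move: (standard_form _) => Q QE.
by rewrite !mxE !QE; elim/ord3P: j => /=; ring.
Qed.

Lemma standard_form1_mul01 :
  q (@Ordinal 3 0 isT) *m q (@Ordinal 3 1 isT) = - q (@Ordinal 3 2 isT).
Proof.
have := @standard_form1E; move: (standard_form _) => Q QE.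
apply/matrixP; elim/ord4P; elim/ord4P; rewrite !mxE sum_ord4 !QE/=; ring.
Qed.

(** Quaternion algebra: the [q j] square to -1 and anticommute, so the cross terms cancel in
    pairs. *)
Lemma standard_form1_comb_sqr c :
  (\sum_j c j *: q j) *m (\sum_j c j *: q j) = - (\sum_j c j ^+ 2)%:M.
Proof.
have := @standard_form1E; move: (standard_form _) => Q QE; rewrite !sum_ord3.
apply/matrixP; elim/ord4P; elim/ord4P; rewrite !mxE sum_ord4 !mxE !QE/=; ring.
Qed.

(** For nonzero [u], the vectors [u] and [u *m (q j)^T] are mutually orthogonal of equal length, and
    [v *m q j *m u^T] is the Euclidean product of [v] with the latter. This is the expansion of [v]
    in that basis, scaled by the squared length of [u]. *)
Lemma standard_form1_expand u v :
  \sum_j (v *m q j *m u^T) 0 0 *: (u *m (q j)^T) =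
  (u *m u^T) 0 0 *: v - (v *m u^T) 0 0 *: u.
Proof.
have := @standard_form1E; move: (standard_form _) => Q QE; rewrite !sum_ord3.
apply/rowP; elim/ord4P; rewrite !mxE !sum_ord4 !mxE !sum_ord4 ?mxE !QE/=; ring.
Qed.

Lemma standard_form1_sqr j : q j *m q j = - 1%:M.
Proof.
have := standard_form1_comb_sqr (fun k => (k == j)%:R).
rewrite (bigD1 j)//= eqxx scale1r big1 ?addr0 => [->|k /negbTE ->]; last first.
  by rewrite scale0r.
rewrite (bigD1 j)//= eqxx expr1n big1 ?addr0// => k /negbTE ->.
by rewrite expr0n.
Qed.

Lemma standard_form1_mul10 :
  q (@Ordinal 3 1 isT) *m q (@Ordinal 3 0 isT) = q (@Ordinal 3 2 isT).
Proof.
apply: trmx_inj; rewrite trmx_mul !standard_form1_tr mulNmx mulmxN opprK.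
exact: standard_form1_mul01.
Qed.

(** [J] is minus the conjugate by [e^T] of the constant combination of the [q j], whose square is
    known. *)
Lemma comb_form_sqr e c : e \in unitmx ->
  let J := (\sum_j c j *: standard_form e j)^T *m invmx (e^T *m e) in
  J *m J = - (\sum_j c j ^+ 2)%:M.
Proof.
move=> eU J; have eTU : e^T \in unitmx by rewrite unitmx_tr.
have -> : J = - (e^T *m (\sum_j c j *: q j) *m invmx e^T).
  rewrite /J linear_sum/= invmx_mul// !mulmx_suml mulmx_sumr mulmx_suml -sumrN.
  apply: eq_bigr => j _; rewrite linearZ/= standard_formE !trmx_mul trmxK.
  rewrite standard_form1_tr -!scalemxAl -scalemxAr -scalemxAl -scalerN.
  congr (_ *: _).
  by rewrite !mulmxA mulmxK// mulmxN !mulNmx.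
rewrite mulNmx mulmxN opprK !mulmxA mulmxKV//.
rewrite -(mulmxA e^T) standard_form1_comb_sqr mulmxN mulNmx mul_mx_scalar.
by rewrite -scalemxAl mulmxV// scalemx1.
Qed.

(** The constant case is applied to the components [u *m e^T] and [v *m e^T] in the orthonormal
    coframe, and [invmx e^T] leads back. *)
Lemma standard_form_expand e u v : e \in unitmx ->
  \sum_j (v *m standard_form e j *m u^T) 0 0 *:
    (u *m (standard_form e j)^T *m invmx (e^T *m e)) =
  (u *m (e^T *m e) *m u^T) 0 0 *: v - (v *m (e^T *m e) *m u^T) 0 0 *: u.
Proof.
move=> eU; have eTU : e^T \in unitmx by rewrite unitmx_tr.
have := standard_form1_expand (u *m e^T) (v *m e^T).
move=> /(congr1 (mulmxr (invmx e^T))) /=.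
rewrite mulmx_suml mulmxBl -!scalemxAl !mulmxK// trmx_mul trmxK !mulmxA => <-.
apply: eq_bigr => j _; rewrite standard_formE invmx_mul// -!scalemxAl.
by rewrite !trmx_mul trmxK !mulmxA mulmxK.
Qed.

Lemma standard_form_unit e j : e \in unitmx -> standard_form e j \in unitmx.
Proof.
move=> eU; rewrite standard_formE !unitmx_mul unitmx_tr eU andbT/=.
have : q j *m (- q j) = 1%:M by rewrite mulmxN standard_form1_sqr opprK.
by case/mulmx1_unit.
Qed.

(** Up to conjugation by [e^T] the two ratios are [q2] and [q0], which anticommute. Ratios of forms
    are endomorphisms, so they can commute with the curvature. *)
Lemma standard_form_ratio_anticomm e : e \in unitmx ->
  let W j := standard_form e j in
  let N01 := W (@Ordinal 3 0 isT) *m invmx (W (@Ordinal 3 1 isT)) in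
  let N12 := W (@Ordinal 3 1 isT) *m invmx (W (@Ordinal 3 2 isT)) in
  N01 *m N12 = - (N12 *m N01).
Proof.
move=> eU W; have eTU : e^T \in unitmx by rewrite unitmx_tr.
have qU j : q j \in unitmx by exact: standard_form_unit (unitmx1 _ _).
have invq j : invmx (q j) = - q j.
  apply: (can_inj (mulKmx (qU j))).
  by rewrite mulmxV// mulmxN standard_form1_sqr opprK.
have NE i j : W i *m invmx (W j) = e^T *m (- (q i *m q j)) *m invmx e^T.
  rewrite /W !(standard_formE e) !invmx_mul ?unitmx_mul ?eTU ?qU// invq.
  by rewrite !mulmxA mulmxK// -(mulmxA e^T) (mulmxN (q i)).
move=> N01 N12; rewrite /N01 /N12 !NE.
move: standard_form1_mul10 standard_form1_mul01.
have := standard_form1_sqr (@Ordinal 3 1 isT).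
move: (q (@Ordinal 3 1 isT)) (q (@Ordinal 3 0 isT)) (q (@Ordinal 3 2 isT)).
move=> q1 q0 q2 q11 q10 q01.
have q12 : q1 *m q2 = - q0 by rewrite -q10 mulmxA q11 mulNmx mul1mx.
have q20 : q2 *m q0 = - (q0 *m q2).
  by rewrite -{2}q10 mulmxA q01 mulNmx opprK.
rewrite q01 q12 !opprK !mulmxA !mulmxKV//.
by rewrite -!(mulmxA e^T) q20 mulNmx mulmxN.
Qed.

End Quaternions.

(** * Ricci-flatness *)

Lemma eq_opp0 (R : numFieldType) (V : lmodType R) (x : V) : x = - x -> x = 0.
Proof.
move=> xN; apply/eqP; have : (2 : R) *: x == 0.
  by rewrite scaler_nat mulr2n {2}xN subrr.
by rewrite scaler_eq0 pnatr_eq0.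
Qed.

Section RicciAlgebra.
Context {R : realType} {n : nat}.
Variable K : 'I_n -> 'I_n -> 'M[R]_n.
Hypothesis KN : forall i j, K j i = - K i j.
Hypothesis bianchi : forall i j l k, K i j l k + K j l i k + K l i j k = 0.

(** [K i j l k] models dx^k(Riem(d_i, d_j) d_l), and the contraction is the one in [ricci]. *)
Let Ric : 'M[R]_n := \matrix_(l, j) \sum_k K k j l k.

(* [tr (K i j *m N)] is evaluated by the Bianchi identity, [N] being moved
   across [K] onto the slot that is not traced. *)
Lemma commuting_ricci_sym (N : 'M[R]_n) :
  (forall i j, K i j *m N = N *m K i j) -> (forall i j, \tr (K i j *m N) = 0) ->
  (N *m Ric)^T = N *m Ric.
Proof.
move=> KNC trKN; apply/matrixP => j i; rewrite mxE.
have NRicE a b : (N *m Ric) a b = \sum_k (K k b *m N) a k.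
  rewrite mxE; under eq_bigr do rewrite mxE mulr_sumr.
  rewrite exchange_big/=; apply: eq_bigr => k _.
  by rewrite KNC mxE.
apply/eqP; rewrite -subr_eq0 -(trKN i j) !NRicE -sumrB /mxtrace; apply/eqP.
apply: eq_bigr => k _; rewrite !mxE -sumrB; apply: eq_bigr => l _.
rewrite -mulrBl; congr (_ * _).
by rewrite -[RHS]subr0 -(bianchi i j k l) (KN k j) mxE; ring.
Qed.

(** Since each form is annihilated by [K], the ratios [N01] and [N12] commute with [K]. The
    identity, [N01], [N12] and their product then all satisfy the hypotheses of
    [commuting_ricci_sym], and N Ric = Ric N^T for all of them is incompatible with anticommutation
    unless Ric = 0. *)
Lemma forms_ricci_flat (W0 W1 W2 : 'M[R]_n) :
  W0 \in unitmx -> W1 \in unitmx -> W2 \in unitmx ->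
  (forall i j, K i j *m W0 + W0 *m (K i j)^T = 0) ->
  (forall i j, K i j *m W1 + W1 *m (K i j)^T = 0) ->
  (forall i j, K i j *m W2 + W2 *m (K i j)^T = 0) ->
  (W0 *m invmx W1) *m (W1 *m invmx W2) =
    - ((W1 *m invmx W2) *m (W0 *m invmx W1)) ->
  Ric = 0.
Proof.
move=> U0 U1 U2 K0 K1 K2; set N01 := W0 *m _; set N12 := W1 *m _ => anti.
have comm V W : W \in unitmx -> (forall i j, K i j *m V + V *m (K i j)^T = 0) ->
    (forall i j, K i j *m W + W *m (K i j)^T = 0) ->
    forall i j, K i j *m (V *m invmx W) = (V *m invmx W) *m K i j.
  move=> WU KV KW i j; apply: (can_inj (mulmxK WU)).
  rewrite !mulmxA mulmxKV// -[_ *m K i j *m W]mulmxA.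
  move: (KV i j) (KW i j) => /eqP; rewrite addr_eq0 => /eqP ->.
  move=> /eqP; rewrite addr_eq0 => /eqP ->.
  by rewrite mulmxN mulmxA mulmxKV.
have C01 : forall i j, K i j *m N01 = N01 *m K i j := comm _ _ U1 K0 K1.
have C12 : forall i j, K i j *m N12 = N12 *m K i j := comm _ _ U2 K1 K2.
have N01U : N01 \in unitmx by rewrite unitmx_mul unitmx_inv U0.
have N12U : N12 \in unitmx by rewrite unitmx_mul unitmx_inv U1.
move: (N01) (N12) anti C01 C12 N01U N12U => {N01 N12} N01 N12 anti.
move=> C01 C12 N01U N12U.
(* tr(K N) = tr(K N P P^-1) = - tr(K P N P^-1) = - tr(P K N P^-1) = - tr(K N). *)
have trN N P : P \in unitmx -> (forall i j, K i j *m P = P *m K i j) ->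
    N *m P = - (P *m N) -> forall i j, \tr (K i j *m N) = 0.
  move=> PU KP NP i j; apply: eq_opp0.
  rewrite -[in RHS](mulmxK PU (K i j *m N)) -[_ *m N *m P]mulmxA NP.
  rewrite mulmxN mulNmx raddfN/= opprK mulmxA KP -!mulmxA [RHS]mxtrace_mulC.
  by rewrite -!mulmxA mulVmx// mulmx1.
(* For N = 1 the trace condition holds because [W0] conjugates [K i j] into minus its transpose. *)
have sym0 : Ric^T = Ric.
  have := @commuting_ricci_sym 1%:M; rewrite mul1mx; apply => i j.
    by rewrite mulmx1 mul1mx.
  rewrite mulmx1; apply: eq_opp0.
  rewrite -[in RHS](mulmxK U0 (K i j)).
  move: (K0 i j) => /eqP; rewrite addr_eq0 => /eqP ->.
  by rewrite mulNmx raddfN/= opprK [RHS]mxtrace_mulC mulmxA mulVmx// mul1mx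
    mxtrace_tr.
have RicN N : (forall i j, K i j *m N = N *m K i j) ->
    (forall i j, \tr (K i j *m N) = 0) -> N *m Ric = Ric *m N^T.
  by move=> KNC trKN; rewrite -(commuting_ricci_sym KNC trKN) trmx_mul sym0.
have R01 := RicN _ C01 (trN _ _ N12U C12 anti).
have anti' : N12 *m N01 = - (N01 *m N12) by rewrite anti opprK.
have R12 := RicN _ C12 (trN _ _ N01U C01 anti').
have C02 i j : K i j *m (N01 *m N12) = (N01 *m N12) *m K i j.
  by rewrite mulmxA C01 -!mulmxA C12.
have anti02 : (N01 *m N12) *m N01 = - (N01 *m (N01 *m N12)).
  by rewrite -mulmxA anti' mulmxN.
have R02 := RicN _ C02 (trN _ _ N01U C01 anti02).
(* Moving the product across at once gives Ric (N01 N12)^T; moving the factors one at a time gives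
   Ric (N12 N01)^T, which is its opposite. *)
have : (N01 *m N12) *m Ric = 0.
  apply: eq_opp0.
  by rewrite [in RHS]R02 [in RHS]anti raddfN/= mulmxN opprK -mulmxA R12 mulmxA R01
    -mulmxA -trmx_mul.
move=> /(congr1 (mulmx (invmx (N01 *m N12)))).
by rewrite mulKmx ?mulmx0// unitmx_mul N01U.
Qed.

End RicciAlgebra.

(** * Curvature in a chart *)

(* With G_i the matrix below, endomorphisms acting on the right of rows,
   nabla_i T = d_i T - G_i T - T G_i^T for every covariant 2-tensor T. *)
HB.lock Definition christoffel_mx (R : realType) (n : nat) (M : topologicalType)
    (A : smooth_atlas R n M) (g : riemannian_metric A) (phi : chart R n M)
    (i : 'I_n) (x : 'rV[R]_n) : 'M[R]_n :=
  \matrix_(j, k) christoffel g phi k i j x.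

(** [Gij] stands for d_i G_j. The hypothesis equates the two mixed second derivatives of a parallel
    [t], with d_i t replaced by G_i t + t G_i^T; the terms with a factor on each side of [t] cancel,
    and the rest is the action of the curvature. *)
Lemma curvature_commutator (R : realType) (n : nat) (Gij Gji Gi Gj t : 'M[R]_n) :
  Gij *m t + Gj *m (Gi *m t + t *m Gi^T)
  + ((Gi *m t + t *m Gi^T) *m Gj^T + t *m Gij^T)
  = Gji *m t + Gi *m (Gj *m t + t *m Gj^T)
    + ((Gj *m t + t *m Gj^T) *m Gi^T + t *m Gji^T) ->
  (Gij - Gji + (Gj *m Gi - Gi *m Gj)) *m t
  + t *m (Gij - Gji + (Gj *m Gi - Gi *m Gj))^T = 0.
Proof.
have trD (X Y : 'M[R]_n) : (X + Y)^T = X^T + Y^T by rewrite linearD.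
have trN (X : 'M[R]_n) : (- X)^T = - X^T by rewrite linearN.
rewrite !(trD, trN) !trmx_mul !(mulmxDl, mulmxDr, mulNmx, mulmxN) !mulmxA.
move: (Gij *m t) (Gji *m t) (t *m Gij^T) (t *m Gji^T) => a1 a2 a3 a4.
move: (Gj *m Gi *m t) (Gi *m Gj *m t) (Gi *m t *m Gj^T) (Gj *m t *m Gi^T)
  => a5 a6 a7 a8.
move: (t *m Gi^T *m Gj^T) (t *m Gj^T *m Gi^T) => a9 a10 /matrixP H.
by apply/matrixP => i j; move: (H i j); rewrite !mxE; lra.
Qed.

Section LocalGeometry.
Context {R : realType} {n : nat} {M : topologicalType}.
Variables (A : smooth_atlas R n M) (g : riemannian_metric A).
Implicit Types (T : tensor02 A) (phi psi : chart R n M) (x u v w : 'rV[R]_n).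
Implicit Types (i j k l m : 'I_n).

Lemma christoffel_mxE phi i j k x :
  christoffel_mx g phi i x j k = christoffel g phi k i j x.
Proof. by rewrite christoffel_mx.unlock mxE. Qed.

Lemma near_cimg phi x : cimg phi x -> \forall y \near x, cimg phi y.
Proof. by move=> phix; apply: open_nbhs_nbhs; split => //; exact: cimg_open. Qed.

Lemma differentiable_tensor T phi x : atlas A phi -> cimg phi x ->
  differentiable (T phi) x.
Proof. by move=> Aphi; exact: (tcomp_smooth T Aphi [::]). Qed.

Lemma differentiable_pderiv_tensor T phi i x : atlas A phi -> cimg phi x ->
  differentiable (pderiv i (T phi)) x.
Proof. by rewrite pderiv.unlock => Aphi; exact: (tcomp_smooth T Aphi [:: i]). Qed.

Lemma pderiv_tensorE T phi i j k x : atlas A phi -> cimg phi x ->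
  pderiv i (fun y => T phi y j k) x = pderiv i (T phi) x j k.
Proof.
by move=> Aphi phix; apply/pderiv_coord/differentiable_tensor.
Qed.

Lemma differentiable_pderiv_entry T phi i j k x : atlas A phi -> cimg phi x ->
  differentiable (pderiv i (fun y => T phi y j k)) x.
Proof.
move=> Aphi phix.
apply: (@near_eq_differentiable _ _ _ (fun y => pderiv i (T phi) y j k)).
  by apply: filterS (near_cimg phix) => y phiy; rewrite pderiv_tensorE.
exact: (differentiable_mxP _ _).1 (differentiable_pderiv_tensor T i Aphi phix) j k.
Qed.

Lemma differentiable_christoffel phi k i j x : atlas A phi -> cimg phi x ->
  differentiable (christoffel g phi k i j) x.
Proof.
move=> Aphi phix; rewrite /christoffel.
under eq_fun do under eq_bigr do rewrite !partialE.
apply: differentiableM; first exact: differentiable_cst.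
apply: differentiable_bigsum => l; apply: differentiableM.
  apply: (differentiable_mxP _ _).1; apply: differentiable_invmx.
    exact: differentiable_tensor.
  by apply: filterS (near_cimg phix) => y phiy; exact: metric_unit.
apply: differentiableB; last exact: differentiable_pderiv_entry.
by apply: differentiableD; exact: differentiable_pderiv_entry.
Qed.

Lemma differentiable_christoffel_mx phi i x : atlas A phi -> cimg phi x ->
  differentiable (christoffel_mx g phi i) x.
Proof.
move=> Aphi phix; apply/differentiable_mxP => j k.
by under eq_fun do rewrite christoffel_mxE; exact: differentiable_christoffel.
Qed.

Lemma pderiv_metric_sym phi i x : atlas A phi -> cimg phi x ->
  (pderiv i (g phi) x)^T = pderiv i (g phi) x.
Proof.
move=> Aphi phix.
have dg := is_derive_pderiv i (differentiable_tensor g Aphi phix).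
have gT : \forall y \near x, (g phi y)^T = g phi y.
  by apply: filterS (near_cimg phix) => y phiy; rewrite Defs.metric_sym.
exact/esym/pderiv_eq/(near_eq_is_derive gT)/is_derive_trmx.
Qed.

Lemma christoffelE phi k i j x : atlas A phi -> cimg phi x ->
  christoffel g phi k i j x = 2^-1 * \sum_l ginv g phi x k l *
    (pderiv i (g phi) x j l + pderiv j (g phi) x i l - pderiv l (g phi) x i j).
Proof.
move=> Aphi phix; rewrite /christoffel.
by congr (_ * _); apply: eq_bigr => l _; rewrite !partialE !pderiv_tensorE.
Qed.

Lemma christoffelC phi k i j x : atlas A phi -> cimg phi x ->
  christoffel g phi k i j x = christoffel g phi k j i x.
Proof.
move=> Aphi phix; rewrite !christoffelE//; congr (_ * _); apply: eq_bigr => l _.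
rewrite [X in _ - X](_ : _ = pderiv l (g phi) x j i); first by congr (_ * _); ring.
by rewrite -[in LHS]pderiv_metric_sym// mxE.
Qed.

(** Christoffel symbols of the first kind: the metric cancels its inverse. *)
Lemma christoffel_lower phi i j l x : atlas A phi -> cimg phi x ->
  (christoffel_mx g phi i x *m g phi x) j l = 2^-1 *
    (pderiv i (g phi) x j l + pderiv j (g phi) x i l - pderiv l (g phi) x i j).
Proof.
move=> Aphi phix; pose D : 'rV[R]_n := \row_l
  (pderiv i (g phi) x j l + pderiv j (g phi) x i l - pderiv l (g phi) x i j).
have -> : (christoffel_mx g phi i x *m g phi x) j l =
    (2^-1 *: (D *m (ginv g phi x)^T) *m g phi x) 0 l.
  rewrite !mxE; apply: eq_bigr => k _; rewrite !mxE christoffel_mxE christoffelE//.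
  by congr (_ * _ * _); apply: eq_bigr => p _; rewrite !mxE mulrC.
rewrite -scalemxAl /ginv trmx_inv Defs.metric_sym// mulmxKV ?metric_unit//.
by rewrite !mxE.
Qed.

(** In the sum of the two lowered symbols every derivative of the metric cancels except d_k g_ij,
    which occurs twice with factor 1/2. *)
Lemma metric_parallel : parallel g g.
Proof.
move=> phi x Aphi phix k i j.
have -> : \sum_l christoffel g phi l k i x * g phi x l j =
    (christoffel_mx g phi k x *m g phi x) i j.
  by rewrite mxE; apply: eq_bigr => l _; rewrite christoffel_mxE.
have -> : \sum_l christoffel g phi l k j x * g phi x i l =
    (christoffel_mx g phi k x *m g phi x) j i.
  rewrite mxE; apply: eq_bigr => l _; rewrite christoffel_mxE; congr (_ * _).
  by rewrite -[in LHS]Defs.metric_sym// mxE.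
rewrite partialE pderiv_tensorE// !christoffel_lower//.
have E a b c : pderiv a (g phi) x b c = pderiv a (g phi) x c b.
  by rewrite -[in LHS]pderiv_metric_sym// mxE.
rewrite (E k j i); set a := pderiv k (g phi) x i j.
by set b := pderiv i (g phi) x k j; set c := pderiv j (g phi) x k i; lra.
Qed.

Lemma pderiv_parallel T phi k x : parallel g T -> atlas A phi -> cimg phi x ->
  pderiv k (T phi) x =
  christoffel_mx g phi k x *m T phi x + T phi x *m (christoffel_mx g phi k x)^T.
Proof.
move=> pT Aphi phix; apply/matrixP => i j; have := pT _ _ Aphi phix k i j.
rewrite partialE pderiv_tensorE// => /eqP; rewrite -addrA -opprD subr_eq0 => /eqP ->.
rewrite !mxE; congr (_ + _); apply: eq_bigr => l _; rewrite ?mxE christoffel_mxE//.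
by rewrite mulrC.
Qed.

(** The connection matrices act on rows from the right, which reverses the order of the products
    compared with the usual formula. *)
Definition curvature_mx phi i j x : 'M[R]_n :=
  pderiv i (christoffel_mx g phi j) x - pderiv j (christoffel_mx g phi i) x
  + (christoffel_mx g phi j x *m christoffel_mx g phi i x
     - christoffel_mx g phi i x *m christoffel_mx g phi j x).

Lemma pderiv_christoffel_mxE phi i j k l x : atlas A phi -> cimg phi x ->
  pderiv i (christoffel_mx g phi j) x l k = pderiv i (christoffel g phi k j l) x.
Proof.
move=> Aphi phix.
have <- : (fun y => christoffel_mx g phi j y l k) = christoffel g phi k j l.
  by apply/funext => y; rewrite christoffel_mxE.
exact/esym/pderiv_coord/differentiable_christoffel_mx.
Qed.

Lemma curvature_mxE phi i j k l x : atlas A phi -> cimg phi x ->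
  curvature_mx phi i j x l k = riemann g phi k l i j x.
Proof.
move=> Aphi phix; rewrite /curvature_mx /riemann !partialE !mxE !pderiv_christoffel_mxE//.
congr (_ + _); rewrite -sumrB; apply: eq_bigr => p _; rewrite !christoffel_mxE.
by rewrite mulrC [X in _ - X]mulrC.
Qed.

Lemma curvature_mxN phi i j x : curvature_mx phi j i x = - curvature_mx phi i j x.
Proof. by rewrite /curvature_mx opprD !opprB. Qed.

(** The curvature is [P a b c - P b a c], where [P] is symmetric in its last two arguments because
    the connection is torsion-free; the cyclic sum then cancels. *)
Lemma curvature_bianchi phi i j l k x : atlas A phi -> cimg phi x ->
  curvature_mx phi i j x l k + curvature_mx phi j l x i k
  + curvature_mx phi l i x j k = 0.
Proof.
move=> Aphi phix.
pose P i j l := pderiv i (christoffel g phi k j l) x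
   + \sum_p christoffel g phi k i p x * christoffel g phi p j l x.
have KP a b c : curvature_mx phi a b x c k = P a b c - P b a c.
  rewrite curvature_mxE// /riemann !partialE sumrB /P opprD; ring.
have PC a b c : P a b c = P a c b.
  rewrite /P; under eq_bigr do rewrite (christoffelC _ b c Aphi phix).
  congr (_ + _); apply: near_eq_pderiv.
  by apply: filterS (near_cimg phix) => y phiy; rewrite christoffelC.
rewrite !KP; move: (P) PC => {KP}P PC.
by rewrite (PC i l j) (PC j l i) (PC l j i); ring.
Qed.

Lemma ricciE phi x : atlas A phi -> cimg phi x ->
  ricci g phi x = \matrix_(l, j) \sum_k curvature_mx phi k j x l k.
Proof.
move=> Aphi phix; apply/matrixP => l j; rewrite !mxE.
by apply: eq_bigr => k _; rewrite curvature_mxE.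
Qed.

(** Integrability condition of the parallel equation: the mixed second derivatives of [T] agree. *)
Lemma curvature_parallel T phi i j x : parallel g T -> atlas A phi -> cimg phi x ->
  curvature_mx phi i j x *m T phi x + T phi x *m (curvature_mx phi i j x)^T = 0.
Proof.
move=> pT Aphi phix.
have comm : pderiv i (pderiv j (T phi)) x = pderiv j (pderiv i (T phi)) x.
  apply: pderiv_comm.
  - apply: filterS (near_cimg phix) => y phiy; exact: differentiable_tensor.
  - exact: differentiable_pderiv_tensor.
  - exact: differentiable_pderiv_tensor.
(* The parallel equation holds on a neighbourhood of [x], so it may be differentiated once more. *)
have dd a b : pderiv a (pderiv b (T phi)) x =
    pderiv a (christoffel_mx g phi b) x *m T phi x
    + christoffel_mx g phi b x *m pderiv a (T phi) x
    + (pderiv a (T phi) x *m (christoffel_mx g phi b x)^T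
       + T phi x *m (pderiv a (christoffel_mx g phi b) x)^T).
  have dT := is_derive_pderiv a (differentiable_tensor T Aphi phix).
  have dG := is_derive_pderiv a (differentiable_christoffel_mx b Aphi phix).
  rewrite -(pderiv_eq (is_deriveD (is_derive_mulmx dG dT)
                                   (is_derive_mulmx dT (is_derive_trmx dG)))).
  apply: near_eq_pderiv.
  by apply: filterS (near_cimg phix) => y phiy; rewrite (pderiv_parallel _ pT).
by apply: curvature_commutator; rewrite -!(pderiv_parallel _ pT)// -!dd.
Qed.

End LocalGeometry.

(** * Vanishing of the Ricci and Schouten tensors of a hyper-Kaehler metric *)

Section HyperKahlerCurvature.
Context {R : realType} {M : topologicalType}.
Variables (A : smooth_atlas R 4 M) (g : riemannian_metric A).
Variables (Omega : 'I_3 -> two_form A) (hK : hyper_kahler g Omega).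
Variables (phi : chart R 4 M) (x : 'rV[R]_4).
Hypotheses (Aphi : atlas A phi) (phix : cimg phi x).

Lemma hyper_kahler_frame : exists e : 'M[R]_4,
  [/\ e \in unitmx, g phi x = e^T *m e & forall j, Omega j phi x = standard_form e j].
Proof.
have [_ /(_ phi x Aphi phix)[U [e [[_ Ux] _ [_ eg] eO]]]] := hK.
have [gE e0] := eg _ Ux.
by exists (e x); split => //; [rewrite unitmxE unitfE gt_eqF | exact: eO].
Qed.

Lemma hyper_kahler_ricci : ricci g phi x = 0.
Proof.
have [e [eU gE OE]] := hyper_kahler_frame; have [pO _] := hK.
rewrite ricciE//.
apply: (@forms_ricci_flat _ _ (fun i j => curvature_mx g phi i j x) _ _
  (standard_form e (@Ordinal 3 0 isT)) (standard_form e (@Ordinal 3 1 isT))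
  (standard_form e (@Ordinal 3 2 isT))).
- by move=> i j; exact: curvature_mxN.
- by move=> i j l k; exact: curvature_bianchi.
- exact: standard_form_unit.
- exact: standard_form_unit.
- exact: standard_form_unit.
- by move=> i j; rewrite -OE; exact: curvature_parallel.
- by move=> i j; rewrite -OE; exact: curvature_parallel.
- by move=> i j; rewrite -OE; exact: curvature_parallel.
- exact: standard_form_ratio_anticomm.
Qed.

Lemma hyper_kahler_schouten : schouten g phi x = 0.
Proof.
rewrite /schouten /scalar_curvature hyper_kahler_ricci.
rewrite big1 ?mul0r ?scale0r ?subr0 ?scaler0// => i _.
by rewrite big1// => j _; rewrite mxE mulr0.
Qed.

End HyperKahlerCurvature.

(** * Change of chart *)

Section Transition.
Context {R : realType} {n : nat} {M : topologicalType}.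
Variables (A : smooth_atlas R n M) (g : riemannian_metric A).
Variables (phi psi : chart R n M).
Hypotheses (Aphi : atlas A phi) (Apsi : atlas A psi).
Implicit Types (x u : 'rV[R]_n).

Let tau := transition phi psi.
Let J x := jacobian tau x.

Lemma near_overlap x : overlap phi psi x -> \forall y \near x, overlap phi psi y.
Proof.
move=> [phix psix].
have : \forall y \near x, cdom psi (cinv phi y).
  apply: (cinv_continuous (mem_set phix)).
  by apply: open_nbhs_nbhs; split => //; exact: cdom_open.
by apply: filterS2 (near_cimg phix).
Qed.

Lemma overlap_transition x : overlap phi psi x -> cimg psi (tau x).
Proof. by move=> [phix psix]; exact: cmap_cimg. Qed.

Lemma differentiable_transition x : overlap phi psi x -> differentiable tau x.
Proof. exact: (atlas_compat Aphi Apsi [::]). Qed.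

Lemma differentiable_pderiv_transition i x : overlap phi psi x ->
  differentiable (pderiv i tau) x.
Proof. rewrite pderiv.unlock; exact: (atlas_compat Aphi Apsi [:: i]). Qed.

Lemma jacobian_pderiv i j x : overlap phi psi x -> J x i j = pderiv i tau x 0 j.
Proof.
move=> ox; rewrite pderiv.unlock /partial deriveEjacobian; last first.
  exact: differentiable_transition.
by rewrite -rowE [RHS]mxE.
Qed.

Lemma differentiable_jacobian x : overlap phi psi x -> differentiable J x.
Proof.
move=> ox; apply/differentiable_mxP => i j.
apply: (@near_eq_differentiable _ _ _ (fun y => pderiv i tau y 0 j)).
  by apply: filterS (near_overlap ox) => y oy; rewrite jacobian_pderiv.
exact: (differentiable_mxP _ _).1 (differentiable_pderiv_transition i ox) 0 j.
Qed.

(** Both sides are second partial derivatives of the transition map. *)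
Lemma pderiv_jacobian_sym m i p x : overlap phi psi x ->
  pderiv m J x i p = pderiv i J x m p.
Proof.
move=> ox; have E a b : pderiv a J x b p = pderiv a (pderiv b tau) x 0 p.
  rewrite -pderiv_coord; last exact: differentiable_jacobian.
  rewrite -[RHS]pderiv_coord; last exact: differentiable_pderiv_transition.
  apply: near_eq_pderiv.
  by apply: filterS (near_overlap ox) => y oy; rewrite jacobian_pderiv.
rewrite !E; congr (fun_of_matrix _ _ _); apply: pderiv_comm.
- by apply: filterS (near_overlap ox) => y; exact: differentiable_transition.
- exact: differentiable_pderiv_transition.
- exact: differentiable_pderiv_transition.
Qed.

Lemma pderiv_metric_transition m x : overlap phi psi x ->
  pderiv m (g phi) x =
    pderiv m J x *m g psi (tau x) *m (J x)^T
    + J x *m (\sum_k J x m k *: pderiv k (g psi) (tau x)) *m (J x)^T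
    + J x *m g psi (tau x) *m (pderiv m J x)^T.
Proof.
move=> ox.
have dJ := is_derive_pderiv m (differentiable_jacobian ox).
have dtau := is_derive_pderiv m (differentiable_transition ox).
have dg := is_derive_comp_rV (differentiable_transition ox) dtau
  (differentiable_tensor g Apsi (overlap_transition ox)).
rewrite -mulmxDl.
under eq_bigr do rewrite jacobian_pderiv//.
rewrite -(pderiv_eq (is_derive_mulmx (is_derive_mulmx dJ dg) (is_derive_trmx dJ))).
apply: near_eq_pderiv; apply: filterS (near_overlap ox) => y oy.
exact: tcomp_transform.
Qed.

(** In the transformation law of the metric the product is invertible, hence so is each factor. *)
Lemma transition_jacobian_unit x : overlap phi psi x -> J x \in unitmx.
Proof.
move=> ox; have := metric_unit g Aphi ox.1.
by rewrite (tcomp_transform g Aphi Apsi ox) !unitmx_mul => /andP[/andP[]].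
Qed.

End Transition.

(** * Transformation of the quadratic term of the acceleration *)

Section ChristoffelQuadratic.
Context {R : realType} {n : nat} {M : topologicalType}.
Variables (A : smooth_atlas R n M) (g : riemannian_metric A).
Implicit Types (phi psi : chart R n M) (x u v : 'rV[R]_n).

(** The term Gamma^k_ij u^i u^j of the geodesic equation. *)
Definition christoffel_quad phi x u : 'rV[R]_n :=
  \sum_i u 0 i *: (u *m christoffel_mx g phi i x).

(** After contraction with [u] twice, the first two terms of [christoffel_lower] coincide, which
    absorbs their factor 1/2. *)
Lemma christoffel_quad_lower phi x u : atlas A phi -> cimg phi x ->
  christoffel_quad phi x u *m g phi x =
  \sum_i u 0 i *: (u *m pderiv i (g phi) x)
  - 2^-1 *: \row_l (u *m pderiv l (g phi) x *m u^T) 0 0.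
Proof.
move=> Aphi phix; apply/rowP => l.
rewrite /christoffel_quad mulmx_suml summxE.
pose a i j := u 0 i * (u 0 j * pderiv i (g phi) x j l).
have -> : \sum_i ((u 0 i *: (u *m christoffel_mx g phi i x)) *m g phi x) 0 l =
    2^-1 * (\sum_i \sum_j a i j + \sum_i \sum_j a j i
            - \sum_i \sum_j u 0 i * pderiv l (g phi) x i j * u 0 j).
  rewrite -big_split -sumrB mulr_sumr; apply: eq_bigr => i _ /=.
  rewrite -big_split -sumrB mulr_sumr -scalemxAl -mulmxA 2!mxE mulr_sumr.
  apply: eq_bigr => j _ /=; rewrite christoffel_lower// /a; ring.
rewrite [X in _ + X - _]exchange_big/= 3!mxE summxE [X in _ - _ * X]mxE.
have -> : \sum_i (u 0 i *: (u *m pderiv i (g phi) x)) 0 l = \sum_i \sum_j a i j.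
  by apply: eq_bigr => i _; rewrite 2!mxE mulr_sumr.
have -> : (u *m pderiv l (g phi) x *m u^T) 0 0 =
    \sum_i \sum_j u 0 i * pderiv l (g phi) x i j * u 0 j.
  rewrite mxE exchange_big/=; apply: eq_bigr => j _.
  by rewrite 2!mxE mulr_suml.
set S := \sum_i \sum_j a i j; lra.
Qed.

(** The inhomogeneous transformation law of the Christoffel symbols, contracted with [u] twice,
    which is the form that the acceleration needs. *)
Lemma christoffel_quad_transition phi psi x u :
  atlas A phi -> atlas A psi -> overlap phi psi x ->
  let J := jacobian (transition phi psi) in
  christoffel_quad phi x u *m J x =
  christoffel_quad psi (transition phi psi x) (u *m J x)
  + \sum_m u 0 m *: (u *m pderiv m J x).
Proof.
move=> Aphi Apsi ox J; set y := transition phi psi x; set v := u *m J x.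
have phix := ox.1; have psiy : cimg psi y := overlap_transition ox.
have JU : J x \in unitmx by exact: (transition_jacobian_unit g Aphi Apsi ox).
have JTU : (J x)^T \in unitmx by rewrite unitmx_tr.
have gU : g psi y \in unitmx by exact: metric_unit.
have gT : (g psi y)^T = g psi y by exact: Defs.metric_sym.
pose D k := pderiv k (g psi) y; pose T m := pderiv m J x.
pose q k := (v *m D k *m v^T) 0 0.
(* Multiplying by [g psi] and [J^T] lowers the index with [g phi] on the left, where the Christoffel
   term is explicit in the derivatives of the metric. *)
apply: (can_inj (mulmxK gU)); apply: (can_inj (mulmxK JTU)).
have -> : christoffel_quad phi x u *m J x *m g psi y *m (J x)^T =
    christoffel_quad phi x u *m g phi x.
  by rewrite [in RHS](tcomp_transform g Aphi Apsi ox) !mulmxA.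
rewrite christoffel_quad_lower// mulmxDl christoffel_quad_lower//.
have DE m : pderiv m (g phi) x = T m *m g psi y *m (J x)^T
    + J x *m (\sum_k J x m k *: D k) *m (J x)^T + J x *m g psi y *m (T m)^T.
  exact: pderiv_metric_transition.
have sum_u : \sum_i u 0 i *: (u *m pderiv i (g phi) x) =
    (\sum_m u 0 m *: (u *m T m)) *m g psi y *m (J x)^T
    + (\sum_k v 0 k *: (v *m D k)) *m (J x)^T
    + \sum_m u 0 m *: (v *m g psi y *m (T m)^T).
  have -> : (\sum_k v 0 k *: (v *m D k)) *m (J x)^T =
      \sum_m u 0 m *: (v *m (\sum_k J x m k *: D k) *m (J x)^T).
    under [RHS]eq_bigr => m _ do
      rewrite mulmx_sumr mulmx_suml scaler_sumr.
    rewrite exchange_big mulmx_suml/=; apply: eq_bigr => k _.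
    rewrite mxE scaler_suml mulmx_suml; apply: eq_bigr => m _.
    by rewrite -scalemxAr -!scalemxAl scalerA.
  rewrite !mulmx_suml -!big_split/=; apply: eq_bigr => m _.
  by rewrite -!scalemxAl -!scalerDr DE !mulmxDr !mulmxA.
have quad_l l : (u *m pderiv l (g phi) x *m u^T) 0 0 =
    2 * (v *m g psi y *m (T l)^T *m u^T) 0 0 + \sum_k J x l k * q k.
  rewrite DE !mulmxDr !mulmxDl !mulmxA -/v mxE [X in X + _]mxE.
  have -> : (u *m T l *m g psi y *m (J x)^T *m u^T) 0 0 =
      (v *m g psi y *m (T l)^T *m u^T) 0 0.
    have tr00 (X : 'M[R]_1) : X 0 0 = X^T 0 0 by rewrite mxE.
    by rewrite [LHS]tr00 !trmx_mul !trmxK gT !mulmxA.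
  have -> : (v *m (\sum_k J x l k *: D k) *m (J x)^T *m u^T) 0 0 =
      \sum_k J x l k * q k.
    rewrite -mulmxA -trmx_mul mulmx_sumr mulmx_suml summxE.
    by apply: eq_bigr => k _; rewrite -scalemxAr -scalemxAl mxE.
  ring.
(* Symmetry of the second derivatives of the transition map enters here: the last term of [sum_u]
   cancels against half of the doubled term in [quad_l]. *)
have sum_T l : (\sum_m u 0 m *: (v *m g psi y *m (T m)^T)) 0 l =
    (v *m g psi y *m (T l)^T *m u^T) 0 0.
  rewrite summxE mxE; apply: eq_bigr => m _; rewrite !mxE mulrC; congr (_ * _).
  apply: eq_bigr => p _; rewrite !mxE; congr (_ * _).
  exact: (pderiv_jacobian_sym Aphi Apsi _ _ _ ox).
apply/rowP => l; rewrite sum_u mulmxDl [LHS]mxE [RHS]mxE.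
have -> : ((\sum_i v 0 i *: (v *m pderiv i (g psi) y)
    - 2^-1 *: \row_l (v *m pderiv l (g psi) y *m v^T) 0 0) *m (J x)^T) 0 l =
    ((\sum_k v 0 k *: (v *m D k)) *m (J x)^T) 0 l - 2^-1 * \sum_k J x l k * q k.
  rewrite mulmxBl mxE; congr (_ + _); rewrite -scalemxAl 3!mxE; congr (- (_ * _)).
  by apply: eq_bigr => k _; rewrite mxE [X in _ * X]mxE mulrC.
have -> : (- (2^-1 *: \row_l (u *m pderiv l (g phi) x *m u^T) 0 0)) 0 l =
    - (v *m g psi y *m (T l)^T *m u^T) 0 0 - 2^-1 * \sum_k J x l k * q k.
  by rewrite 3!mxE quad_l; field.
rewrite 2!mxE sum_T /T; set a := (_ *m g psi y *m (J x)^T) 0 l.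
set b := (_ *m (J x)^T) 0 l; set c := (_ *m u^T) 0 0; lra.
Qed.

End ChristoffelQuadratic.

(** * Covariant derivatives along a curve *)

Section Curve.
Context {R : realType} {n : nat} {M : topologicalType}.
Variables (A : smooth_atlas R n M) (g : riemannian_metric A).
Variables (I : set R) (gamma : R -> M).
Hypotheses (I_open : open I) (gamma_smooth : smooth_curve A I gamma).
Implicit Types (phi psi : chart R n M) (t s : R) (W : R -> 'rV[R]_n).

Let dom phi : set R := I `&` gamma @^-1` cdom phi.
Let c phi : R -> 'rV[R]_n := cmap phi \o gamma.
Let vel phi := velocity gamma phi.
Let acc phi := acceleration g gamma phi.

Lemma near_dom phi t : dom phi t -> \forall s \near t, dom phi s.
Proof.
move=> [It phit]; have [gc _] := gamma_smooth.
have : \forall s \near t, cdom phi (gamma s).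
  apply: (gc _ (mem_set It)).
  by apply: open_nbhs_nbhs; split => //; exact: cdom_open.
have : \forall s \near t, I s by exact: open_nbhs_nbhs.
exact: filterS2.
Qed.

Lemma curve_cimg phi t : dom phi t -> cimg phi (c phi t).
Proof. by move=> [_ phit]; exact: cmap_cimg. Qed.

Lemma differentiable_curve phi t : atlas A phi -> dom phi t ->
  differentiable (c phi) t.
Proof.
by move=> Aphi dt; apply/derivable1_diffP; exact: (gamma_smooth.2 _ Aphi 0).
Qed.

Lemma differentiable_velocity phi t : atlas A phi -> dom phi t ->
  differentiable (vel phi) t.
Proof.
by move=> Aphi dt; apply/derivable1_diffP; exact: (gamma_smooth.2 _ Aphi 1).
Qed.

Lemma differentiable_tderiv_velocity phi t : atlas A phi -> dom phi t ->
  differentiable (tderiv (vel phi)) t.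
Proof.
rewrite tderiv.unlock => Aphi dt; apply/derivable1_diffP.
exact: (gamma_smooth.2 _ Aphi 2).
Qed.

Lemma velocityE phi t : vel phi t = tderiv (c phi) t.
Proof. by rewrite tderiv.unlock. Qed.

Lemma is_derive_curve phi t : atlas A phi -> dom phi t ->
  is_derive t 1 (c phi) (vel phi t).
Proof.
move=> Aphi dt; rewrite velocityE; apply: is_derive_tderiv.
exact/derivable1_diffP/differentiable_curve.
Qed.

(** The connection form evaluated on the velocity: nabla_u W is W' plus [W] times this matrix. *)
Definition connection_mx phi t : 'M[R]_n :=
  \sum_i vel phi t 0 i *: christoffel_mx g phi i (c phi t).

Lemma cov_derivativeE phi W t :
  cov_derivative g gamma phi W t = tderiv W t + W t *m connection_mx phi t.
Proof.
rewrite /cov_derivative tderiv.unlock; congr (_ + _); apply/rowP => k.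
rewrite mulmx_sumr summxE mxE; apply: eq_bigr => i _.
rewrite -scalemxAr 2!mxE mulr_sumr; apply: eq_bigr => j _.
by rewrite christoffel_mxE; ring.
Qed.

Lemma accelerationE phi t :
  acc phi t = tderiv (vel phi) t + christoffel_quad g phi (c phi t) (vel phi t).
Proof.
rewrite /acc /acceleration cov_derivativeE; congr (_ + _).
by rewrite mulmx_sumr; apply: eq_bigr => i _; rewrite -scalemxAr.
Qed.

Lemma differentiable_acceleration phi t : atlas A phi -> dom phi t ->
  differentiable (acc phi) t.
Proof.
move=> Aphi dt.
have -> : acc phi = fun s => tderiv (vel phi) s + vel phi s *m connection_mx phi s.
  by apply/funext => s; rewrite /acc /acceleration cov_derivativeE.
apply: differentiableD; first exact: differentiable_tderiv_velocity.
apply: differentiable_mulmx; first exact: differentiable_velocity.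
apply/differentiable_mxP => j k; under eq_fun do rewrite summxE.
apply: differentiable_bigsum => i; under eq_fun do rewrite mxE.
apply: differentiableM.
  by apply: (differentiable_mxP _ _).1; exact: differentiable_velocity.
apply: (differentiable_mxP (fun s => christoffel_mx g phi i (c phi s)) t).1.
apply: (@differentiable_comp _ _ _ _ (c phi)); first exact: differentiable_curve.
by apply: differentiable_christoffel_mx => //; exact: curve_cimg.
Qed.

(** Stated for bare component functions at one point, so that it covers constant combinations of the
    Omega^j without packaging them as tensor fields. *)
Definition parallel_at phi (F : 'rV[R]_n -> 'M[R]_n) (x : 'rV[R]_n) : Prop :=
  differentiable F x /\ forall k,
    pderiv k F x =
    christoffel_mx g phi k x *m F x + F x *m (christoffel_mx g phi k x)^T.

Lemma parallel_atP (T : tensor02 A) phi x : parallel g T -> atlas A phi ->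
  cimg phi x -> parallel_at phi (T phi) x.
Proof.
move=> pT Aphi phix; split; first exact: differentiable_tensor.
by move=> k; exact: pderiv_parallel.
Qed.

(** Leibniz rule for the covector F(W, .) with F parallel; the last term is the connection term of a
    covector. *)
Lemma is_derive_parallel_row F phi W t : atlas A phi -> dom phi t ->
  parallel_at phi F (c phi t) -> differentiable W t ->
  is_derive t 1 (fun s => W s *m F (c phi s))
    (cov_derivative g gamma phi W t *m F (c phi t)
     + W t *m F (c phi t) *m (connection_mx phi t)^T).
Proof.
move=> Aphi dt [dF pF] dW.
have dFc := is_derive_comp_rV (differentiable_curve Aphi dt)
  (is_derive_curve Aphi dt) dF.
have dW' : is_derive t 1 W (tderiv W t) by exact/is_derive_tderiv/derivable1_diffP.
apply: is_derive_eq (is_derive_mulmx dW' dFc) _.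
rewrite cov_derivativeE mulmxDl -addrA; congr (_ + _).
rewrite -!mulmxA -mulmxDr; congr (_ *m _).
rewrite /connection_mx mulmx_suml linear_sum mulmx_sumr -big_split/=.
by apply: eq_bigr => i _; rewrite pF linearZ/= -scalemxAl -scalemxAr scalerDr.
Qed.

(** The covector connection term of the previous lemma completes the derivative of [W] to its
    covariant derivative. *)
Lemma is_derive_parallel_form F phi V W t : atlas A phi -> dom phi t ->
  parallel_at phi F (c phi t) -> differentiable V t -> differentiable W t ->
  is_derive t 1 (fun s => (V s *m F (c phi s) *m (W s)^T) 0 0)
    ((cov_derivative g gamma phi V t *m F (c phi t) *m (W t)^T) 0 0
     + (V t *m F (c phi t) *m (cov_derivative g gamma phi W t)^T) 0 0).
Proof.
move=> Aphi dt pF dV dW.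
have dVF := is_derive_parallel_row Aphi dt pF dV.
have dW' : is_derive t 1 W (tderiv W t) by exact/is_derive_tderiv/derivable1_diffP.
have := (is_derive_mxP _ _ _ _).1 (is_derive_mulmx dVF (is_derive_trmx dW')) 0 0.
move=> dVFW; apply: is_derive_eq dVFW _;
set DV := cov_derivative g gamma phi V t; set x := c phi t.
transitivity ((DV *m F x *m (W t)^T
  + V t *m F x *m (cov_derivative g gamma phi W t)^T) 0 0); last by rewrite mxE.
congr (fun_of_matrix _ _ _); rewrite [in RHS]cov_derivativeE linearD/= trmx_mul.
rewrite mulmxDl mulmxDr -addrA.
by rewrite [X in _ + X]addrC -!mulmxA.
Qed.

Lemma curve_overlap phi psi t :
  dom phi t -> dom psi t -> overlap phi psi (c phi t).
Proof.
move=> dphi dpsi; split; first exact: curve_cimg.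
by rewrite /c /= cmapK; [exact: dpsi.2 | exact: dphi.2].
Qed.

Lemma curve_transition phi psi t :
  dom phi t -> c psi t = transition phi psi (c phi t).
Proof. by move=> dphi; rewrite /c /transition /= cmapK//; exact: dphi.2. Qed.

Lemma velocity_transition phi psi t :
  atlas A phi -> atlas A psi -> dom phi t -> dom psi t ->
  vel psi t = vel phi t *m jacobian (transition phi psi) (c phi t).
Proof.
move=> Aphi Apsi dphi dpsi; have ov := curve_overlap dphi dpsi.
have dtau := differentiable_transition Aphi Apsi ov.
have dtc := is_derive_comp_rV (differentiable_curve Aphi dphi)
  (is_derive_curve Aphi dphi) dtau.
rewrite velocityE; apply: tderiv_eq.
apply: (@near_eq_is_derive _ _ _ (transition phi psi \o c phi)).
  apply: filterS (near_dom dphi) => s ds; exact/esym/curve_transition.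
apply: is_derive_eq dtc _; apply/rowP => j.
rewrite summxE mxE; apply: eq_bigr => i _.
by rewrite mxE (jacobian_pderiv Aphi Apsi).
Qed.

(** Differentiating the transformed velocity produces second derivatives of the transition map,
    exactly the inhomogeneous term in the law for [christoffel_quad]. *)
Lemma acceleration_transition phi psi t :
  atlas A phi -> atlas A psi -> dom phi t -> dom psi t ->
  acc psi t = acc phi t *m jacobian (transition phi psi) (c phi t).
Proof.
move=> Aphi Apsi dphi dpsi; have ov := curve_overlap dphi dpsi.
set J := jacobian _.
have dJ := differentiable_jacobian Aphi Apsi ov.
have dJc := is_derive_comp_rV (differentiable_curve Aphi dphi)
  (is_derive_curve Aphi dphi) dJ.
have dv : is_derive t 1 (vel phi) (tderiv (vel phi) t).
  exact/is_derive_tderiv/derivable1_diffP/differentiable_velocity.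
have vE : tderiv (vel psi) t = tderiv (vel phi) t *m J (c phi t)
    + vel phi t *m (\sum_i vel phi t 0 i *: pderiv i J (c phi t)).
  apply: tderiv_eq; apply: near_eq_is_derive (is_derive_mulmx dv dJc).
  near=> s; apply/esym/velocity_transition => //.
    by near: s; exact: near_dom.
  by near: s; exact: near_dom.
rewrite !accelerationE vE mulmxDl -addrA; congr (_ + _).
rewrite (christoffel_quad_transition g _ Aphi Apsi ov) -/J.
rewrite -velocity_transition// -curve_transition// addrC; congr (_ + _).
by rewrite mulmx_sumr; apply: eq_bigr => i _; rewrite scalemxAr.
Unshelve. all: by end_near. Qed.

Lemma tensor_transition (T : tensor02 A) phi psi t (v w : 'rV[R]_n) :
  atlas A phi -> atlas A psi -> dom phi t -> dom psi t ->
  let J := jacobian (transition phi psi) (c phi t) in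
  v *m T phi (c phi t) *m w^T = (v *m J) *m T psi (c psi t) *m (w *m J)^T.
Proof.
move=> Aphi Apsi dphi dpsi J; have ov := curve_overlap dphi dpsi.
rewrite (tcomp_transform T Aphi Apsi ov) (curve_transition psi dphi).
by rewrite trmx_mul !mulmxA.
Qed.

(** A chart is chosen at each parameter. The resulting function does not depend on the choice, so
    near each parameter it agrees with [Q] in one fixed chart and has zero derivative. *)
Lemma locally_constant_along (Q : chart R n M -> R -> R) :
  is_interval I ->
  (forall t phi psi, atlas A phi -> atlas A psi -> dom phi t -> dom psi t ->
    Q phi t = Q psi t) ->
  (forall t phi, atlas A phi -> dom phi t -> is_derive t 1 (Q phi) 0) ->
  exists r, along A I gamma (fun phi t => Q phi t = r).
Proof.
move=> itvI Qinv dQ.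
have cover t : {phi | atlas A phi & cdom phi (gamma t)}.
  by apply: cid2; exact: atlas_cover.
pose f t := Q (s2val (cover t)) t.
have [[t0 It0]|I0] := pselect (exists t, I t); last first.
  by exists 0 => t It; case: I0; exists t.
have fQ t phi : atlas A phi -> dom phi t -> Q phi t = f t.
  move=> Aphi dt; apply: Qinv => //; first exact: (s2valP (cover t)).
  by split; [exact: dt.1 | exact: (s2valP' (cover t))].
have df t : I t -> is_derive t 1 f 0.
  move=> It; set phi := s2val (cover t).
  have Aphi : atlas A phi by exact: (s2valP (cover t)).
  have dt : dom phi t by split => //; exact: (s2valP' (cover t)).
  apply: near_eq_is_derive (dQ t phi Aphi dt).
  by apply: filterS (near_dom dt) => s ds; exact: fQ.
exists (f t0) => t It phi Aphi phit; rewrite fQ//.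
by apply: (derive0_interval_cst itvI df).
Qed.

End Curve.

(** * Conformal geodesics and the Lorentz force *)

Section LorentzForce.
Context {R : realType} {M : topologicalType}.
Variables (A : smooth_atlas R 4 M) (g : riemannian_metric A).
Variables (Omega : 'I_3 -> two_form A) (hK : hyper_kahler g Omega).
Variables (I : set R) (gamma : R -> M).
Hypotheses (I_open : open I) (I_interval : is_interval I).
Hypotheses (gamma_smooth : smooth_curve A I gamma).
Hypothesis (gamma_unit : unit_speed g I gamma).
Implicit Types (phi psi : chart R 4 M) (t s : R) (v w : 'rV[R]_4).

Let dom phi : set R := I `&` gamma @^-1` cdom phi.
Let c phi : R -> 'rV[R]_4 := cmap phi \o gamma.
Let vel phi := velocity gamma phi.
Let acc phi := acceleration g gamma phi.

Lemma inner_ge0 phi x v : atlas A phi -> cimg phi x -> 0 <= inner g phi x v v.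
Proof.
move=> Aphi phix; have [->|v0] := eqVneq v 0.
  by rewrite /inner !mul0mx mxE.
by apply: ltW; exact: metric_pos.
Qed.

Lemma sqr_gnorm phi x v : atlas A phi -> cimg phi x ->
  Defs.gnorm g phi x v ^+ 2 = inner g phi x v v.
Proof. by move=> Aphi phix; rewrite sqr_sqrtr// inner_ge0. Qed.

Lemma innerC phi x v w : atlas A phi -> cimg phi x ->
  inner g phi x v w = inner g phi x w v.
Proof.
move=> Aphi phix; have tr00 (X : 'M[R]_1) : X 0 0 = X^T 0 0 by rewrite mxE.
by rewrite /inner [LHS]tr00 !trmx_mul trmxK Defs.metric_sym// mulmxA.
Qed.

Lemma innerZl phi x a v w : inner g phi x (a *: v) w = a * inner g phi x v w.
Proof. by rewrite /inner -!scalemxAl mxE. Qed.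

Lemma innerZr phi x a v w : inner g phi x v (a *: w) = a * inner g phi x v w.
Proof. by rewrite /inner linearZ/= -scalemxAr mxE. Qed.

Lemma two_form_diag j phi x v : atlas A phi -> cimg phi x ->
  (v *m Omega j phi x *m v^T) 0 0 = 0.
Proof.
move=> Aphi phix; apply: (@eq_opp0 _ R^o).
have tr00 (X : 'M[R]_1) : X 0 0 = X^T 0 0 by rewrite mxE.
rewrite [LHS]tr00 !trmx_mul trmxK form_alt// mulNmx mulmxN mulmxA.
by rewrite [LHS]mxE.
Qed.

Lemma inner_velocity phi t : atlas A phi -> dom phi t ->
  inner g phi (c phi t) (vel phi t) (vel phi t) = 1.
Proof.
move=> Aphi dt; have phix := curve_cimg dt.
rewrite -sqr_gnorm// gamma_unit ?expr1n//; [exact: dt.1 | exact: dt.2].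
Qed.

(** Half the derivative of the constant g(u, u) = 1. *)
Lemma inner_velocity_acceleration phi t : atlas A phi -> dom phi t ->
  inner g phi (c phi t) (acc phi t) (vel phi t) = 0.
Proof.
move=> Aphi dt; have phix := curve_cimg dt.
have dv := differentiable_velocity gamma_smooth Aphi dt.
have pg := parallel_atP (metric_parallel g) Aphi phix.
have := is_derive_parallel_form gamma_smooth Aphi dt pg dv dv.
have d0 : is_derive t 1 (fun s => inner g phi (c phi s) (vel phi s) (vel phi s)) 0.
  apply: near_eq_is_derive (is_derive_cst (1 : R) t (1 : R)).
  apply: filterS (near_dom I_open gamma_smooth dt) => s ds.
  by rewrite inner_velocity.
move=> [_]; have [_ ->] := d0 => /esym.
rewrite -/(inner g phi (c phi t) (acc phi t) (vel phi t)).
rewrite -/(inner g phi (c phi t) (vel phi t) (acc phi t)).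
by rewrite [X in _ + X]innerC// -mulr2n => /eqP; rewrite mulrn_eq0/= => /eqP.
Qed.

Lemma conformal_geodesicP :
  conformal_geodesic g I gamma <->
  along A I gamma (fun phi t => cov_derivative g gamma phi (acc phi) t =
    - inner g phi (c phi t) (acc phi t) (acc phi t) *: vel phi t).
Proof.
by split=> H t It phi Aphi phit; have := H t It phi Aphi phit;
  have phix := curve_cimg (conj It phit : dom phi t);
  rewrite /= (hyper_kahler_schouten hK Aphi phix) sqr_gnorm// /sharp;
  rewrite mulmx0 !mul0mx mxE !addr0.
Qed.

(** In the expansion along u, J_1 u, J_2 u, J_3 u the term in u drops out by orthogonality, and |u|
    = 1 removes the scale factor. *)
Lemma acceleration_expand phi t : atlas A phi -> dom phi t ->
  acc phi t = \sum_j (acc phi t *m Omega j phi (c phi t) *m (vel phi t)^T) 0 0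
    *: endo_of_form g phi (c phi t) (Omega j phi (c phi t)) (vel phi t).
Proof.
move=> Aphi dt; have phix := curve_cimg dt.
have [e [eU gE OE]] := hyper_kahler_frame hK Aphi phix.
have := standard_form_expand (vel phi t) (acc phi t) eU.
rewrite -gE -/(inner g phi (c phi t) (vel phi t) (vel phi t)) inner_velocity//.
rewrite -/(inner g phi (c phi t) (acc phi t) (vel phi t)).
rewrite inner_velocity_acceleration// scale1r scale0r subr0 => /esym aE.
by apply: etrans aE _; apply: eq_bigr => j _; rewrite -OE.
Qed.

(** Substituting the expansion in the second slot leaves the products g(a, J_j u) = Omega^j(a,
    u). *)
Lemma inner_acceleration phi t : atlas A phi -> dom phi t ->
  inner g phi (c phi t) (acc phi t) (acc phi t) =
  \sum_j (acc phi t *m Omega j phi (c phi t) *m (vel phi t)^T) 0 0 ^+ 2.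
Proof.
move=> Aphi dt; have phix := curve_cimg dt.
rewrite {2}acceleration_expand// /inner linear_sum mulmx_sumr summxE.
apply: eq_bigr => j _; rewrite linearZ/= -scalemxAr mxE expr2; congr (_ * _).
exact: endo_of_formP.
Qed.

Lemma parallel_at_comb (k : 'I_3 -> R) phi x : atlas A phi -> cimg phi x ->
  parallel_at g phi (fun y => \sum_j k j *: Omega j phi y) x.
Proof.
move=> Aphi phix.
have FE : (fun y => \sum_j k j *: Omega j phi y) = \sum_j (k j \*: Omega j phi).
  by apply/funext => y; rewrite fct_sumE.
split=> [|i].
  rewrite FE; apply: differentiable_sum => j; apply: differentiableZ.
  exact: differentiable_tensor.
have dO j := is_derive_pderiv i (differentiable_tensor (Omega j) Aphi phix).
have -> : pderiv i (fun y => \sum_j k j *: Omega j phi y) x =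
    \sum_j k j *: pderiv i (Omega j phi) x.
  by rewrite FE; apply: pderiv_eq; apply: is_derive_sum => j; exact: is_deriveZ.
rewrite mulmx_sumr mulmx_suml -big_split/=; apply: eq_bigr => j _.
by rewrite (pderiv_parallel _ (hK.1 j))// -scalemxAl -scalemxAr scalerDr.
Qed.

(** * From conformal geodesics to the Lorentz force *)

Section Forward.
Hypothesis conf : along A I gamma (fun phi t =>
  cov_derivative g gamma phi (acc phi) t =
    - inner g phi (c phi t) (acc phi t) (acc phi t) *: vel phi t).

(** The derivative of |a|^2 is 2 g(nabla_u a, a) = -2 |a|^2 g(u, a) = 0. *)
Lemma inner_acceleration_constant : exists r, along A I gamma (fun phi t =>
  inner g phi (c phi t) (acc phi t) (acc phi t) = r).
Proof.
apply: (locally_constant_along I_open gamma_smooth I_interval).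
  move=> t phi psi Aphi Apsi dphi dpsi.
  rewrite /inner (tensor_transition g _ _ Aphi Apsi dphi dpsi).
  by rewrite /acc (acceleration_transition g I_open gamma_smooth Aphi Apsi dphi dpsi).
move=> t phi Aphi dt; have phix := curve_cimg dt.
have da := differentiable_acceleration g gamma_smooth Aphi dt.
have pg := parallel_atP (metric_parallel g) Aphi phix.
apply: is_derive_eq (is_derive_parallel_form gamma_smooth Aphi dt pg da da) _.
rewrite (conf dt.1 Aphi dt.2).
set r := - inner _ _ _ _ _; set u := velocity gamma phi t.
rewrite -/(inner g phi (c phi t) (r *: u) (acc phi t)).
rewrite -/(inner g phi (c phi t) (acc phi t) (r *: u)) innerZl innerZr.
by rewrite [X in r * X]innerC// inner_velocity_acceleration// mulr0 addr0.
Qed.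

(** The derivative is Omega^j(nabla_u a, u) + Omega^j(a, a) = -|a|^2 Omega^j(u, u) + 0, which
    vanishes by antisymmetry. *)
Lemma form_acceleration_constant j : exists r, along A I gamma (fun phi t =>
  (acc phi t *m Omega j phi (c phi t) *m (vel phi t)^T) 0 0 = r).
Proof.
apply: (locally_constant_along I_open gamma_smooth I_interval).
  move=> t phi psi Aphi Apsi dphi dpsi.
  rewrite (tensor_transition (Omega j) _ _ Aphi Apsi dphi dpsi).
  rewrite /acc (acceleration_transition g I_open gamma_smooth Aphi Apsi dphi dpsi).
  by rewrite /vel (velocity_transition I_open gamma_smooth Aphi Apsi dphi dpsi).
move=> t phi Aphi dt; have phix := curve_cimg dt.
have dv := differentiable_velocity gamma_smooth Aphi dt.
have da := differentiable_acceleration g gamma_smooth Aphi dt.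
have pO := parallel_atP (hK.1 j) Aphi phix.
apply: is_derive_eq (is_derive_parallel_form gamma_smooth Aphi dt pO da dv) _.
rewrite (conf dt.1 Aphi dt.2) -!scalemxAl mxE !two_form_diag//.
by rewrite mulr0 addr0.
Qed.

Lemma conformal_geodesic_lorentz_force : constant_acceleration_norm g I gamma /\
  exists k : 'I_3 -> R, \sum_j k j ^+ 2 = 1 /\
    lorentz_force g I gamma (fun phi x => \sum_j k j *: Omega j phi x).
Proof.
have [r rE] := inner_acceleration_constant.
have [k kE] := choice form_acceleration_constant.
split.
  exists (Num.sqrt r) => t It phi Aphi phit.
  by rewrite /Defs.gnorm; congr Num.sqrt; exact: rE.
have delta_sqr : \sum_(j < 3) (j == 0)%:R ^+ 2 = 1 :> R.
  by rewrite big_ord_recl/= expr1n big1 ?addr0// => j _; rewrite expr0n.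
(* On an empty interval any unit vector serves as c. *)
have [[t0 It0]|I0] := pselect (exists t, I t); last first.
  by exists (fun j => (j == 0)%:R); split => // t It; case: I0; exists t.
have r_sum : r = \sum_j k j ^+ 2.
  have [phi Aphi phit] := atlas_cover A (gamma t0).
  rewrite -(rE t0 It0 phi Aphi phit) inner_acceleration//.
  by apply: eq_bigr => j _; rewrite (kE j t0 It0 phi Aphi phit).
have aE t phi : atlas A phi -> dom phi t -> acc phi t =
    endo_of_form g phi (c phi t) (\sum_j k j *: Omega j phi (c phi t)) (vel phi t).
  move=> Aphi dt; rewrite [LHS]acceleration_expand//.
  rewrite /endo_of_form linear_sum mulmx_sumr mulmx_suml/=.
  apply: eq_bigr => j _; rewrite (kE j t dt.1 phi Aphi dt.2).
  by rewrite linearZ/= -scalemxAr -scalemxAl.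
(* If a = 0, both sides of the force equation vanish for every c, and a fixed unit vector is
   taken. *)
have [r0|r0] := eqVneq r 0.
  exists (fun j => (j == 0)%:R); split => // t It phi Aphi phit.
  have k0 j : k j = 0.
    apply/eqP; rewrite -sqrf_eq0; move/eqP: r_sum; rewrite r0 eq_sym psumr_eq0.
      by move=> /allP/(_ j (mem_index_enum _)).
    by move=> i _; exact: sqr_ge0.
  have a0 : acceleration g gamma phi t = 0.
    rewrite [LHS]aE// big1 ?/endo_of_form ?trmx0 ?mulmx0 ?mul0mx// => j _.
    by rewrite k0 scale0r.
  by rewrite a0 /Defs.gnorm /inner !mul0mx mxE sqrtr0 scale0r.
have r_gt0 : 0 < r.
  by rewrite lt_neqAle eq_sym r0 r_sum sumr_ge0// => j _; exact: sqr_ge0.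
(* Here [r] is |a|^2, so these are the coefficients Omega^j(a, u) / |a|. *)
exists (fun j => k j / Num.sqrt r); split.
  under eq_bigr do rewrite exprMn exprVn sqr_sqrtr ?(ltW r_gt0)//.
  by rewrite -mulr_suml -r_sum divff.
move=> t It phi Aphi phit; rewrite /Defs.gnorm (rE t It phi Aphi phit).
rewrite [LHS]aE//.
have -> : \sum_j k j *: Omega j phi (c phi t) =
    Num.sqrt r *: \sum_j (k j / Num.sqrt r) *: Omega j phi (c phi t).
  rewrite scaler_sumr; apply: eq_bigr => j _; rewrite scalerA mulrC divfK//.
  by rewrite gt_eqF// sqrtr_gt0.
by rewrite /endo_of_form linearZ/= -scalemxAr -scalemxAl.
Qed.

End Forward.

(** * From the Lorentz force to conformal geodesics *)

Lemma lorentz_force_conformal_geodesic (k : 'I_3 -> R) :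
  constant_acceleration_norm g I gamma ->
  \sum_j k j ^+ 2 = 1 ->
  lorentz_force g I gamma (fun phi x => \sum_j k j *: Omega j phi x) ->
  along A I gamma (fun phi t => cov_derivative g gamma phi (acc phi) t =
    - inner g phi (c phi t) (acc phi t) (acc phi t) *: vel phi t).
Proof.
move=> [r rE] k1 lor t It phi Aphi phit.
have dt : dom phi t by [].
have phix := curve_cimg dt.
pose F y := \sum_j k j *: Omega j phi y.
have dv := differentiable_velocity gamma_smooth Aphi dt.
have da := differentiable_acceleration g gamma_smooth Aphi dt.
have pg := parallel_atP (metric_parallel g) Aphi phix.
have pF : parallel_at g phi F (c phi t) by exact: parallel_at_comb.
have gU : g phi (c phi t) \in unitmx by exact: metric_unit.
have FT y : cimg phi y -> (F y)^T = - F y.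
  move=> phiy; rewrite /F linear_sum -sumrN; apply: eq_bigr => j _.
  by rewrite linearZ/= form_alt// scalerN.
have aE s : dom phi s ->
    acc phi s = r *: (vel phi s *m (F (c phi s))^T *m invmx (g phi (c phi s))).
  move=> ds; rewrite -(rE s ds.1 phi Aphi ds.2); exact: lor ds.1 phi Aphi ds.2.
(* Lowering the index removes the inverse metric: the force equation becomes an identity of
   covectors, valid near [t] and so open to differentiation. The sign comes from the antisymmetry of
   F. *)
have agE : \forall s \near t,
    - r *: (vel phi s *m F (c phi s)) = acc phi s *m g phi (c phi s).
  apply: filterS (near_dom I_open gamma_smooth dt) => s ds.
  have phis := curve_cimg ds.
  rewrite aE// -scalemxAl mulmxKV ?metric_unit// FT// mulmxN scalerN scaleNr.
  by [].
(* Both sides contract a vector with a parallel tensor. Their derivatives carry the same covector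
   connection term, and cancelling it leaves nabla_u a = r J(a). *)
have dag := is_derive_parallel_row gamma_smooth Aphi dt pg da.
have dvF := is_derive_parallel_row gamma_smooth Aphi dt pF dv.
have [_ dE] := near_eq_is_derive agE (is_deriveZ (- r) dvF).
move: dag => [_]; rewrite dE => {dE}.
rewrite -/(acc phi) scalerDr => E.
have agt : acc phi t *m g phi (c phi t) = - r *: (vel phi t *m F (c phi t)).
  by rewrite (nbhs_singleton agE).
move: E; rewrite agt -scalemxAl => /addIr DaE.
have {}DaE : cov_derivative g gamma phi (acc phi) t =
    r *: (acc phi t *m (F (c phi t))^T *m invmx (g phi (c phi t))).
  apply: (can_inj (mulmxK gU)); rewrite -DaE FT// -scalemxAl mulmxKV//.
  by rewrite mulmxN scalerN scaleNr.
have [e [eU gE OE]] := hyper_kahler_frame hK Aphi phix.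
pose J := (F (c phi t))^T *m invmx (g phi (c phi t)).
have JJ : J *m J = - 1%:M.
  have FE : F (c phi t) = \sum_j k j *: standard_form e j.
    by apply: eq_bigr => j _; rewrite -OE.
  by rewrite -k1 -(comb_form_sqr k eU) /J FE gE.
have aJ : acc phi t = r *: (vel phi t *m J) by rewrite /J mulmxA; exact: aE.
have -> : inner g phi (c phi t) (acc phi t) (acc phi t) = r ^+ 2.
  by rewrite -sqr_gnorm// (rE t It phi Aphi phit).
rewrite DaE -mulmxA -/J aJ -scalemxAl -mulmxA JJ mulmxN mulmx1 scalerA -expr2.
by rewrite scalerN scaleNr.
Qed.

End LorentzForce.

Theorem proposition3p1 (R : realType) (M : topologicalType)
    (M_hausdorff : hausdorff_space M) (M_countable : @second_countable M)
    (A : smooth_atlas R 4 M) (A_oriented : oriented A)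
    (g : riemannian_metric A) (Omega : 'I_3 -> two_form A)
    (hK : hyper_kahler g Omega)
    (I : set R) (I_open : open I) (I_interval : is_interval I)
    (gamma : R -> M) (gamma_smooth : smooth_curve A I gamma)
    (gamma_unit : unit_speed g I gamma) :
  conformal_geodesic g I gamma <->
  constant_acceleration_norm g I gamma /\
  exists c : 'I_3 -> R,
    \sum_j c j ^+ 2 = 1 /\
    lorentz_force g I gamma (fun phi x => \sum_j c j *: Omega j phi x).
Proof.
rewrite (conformal_geodesicP hK); split=> [conf|[rE [c [c1 lor]]]].
  exact: (conformal_geodesic_lorentz_force hK I_open I_interval gamma_smooth
    gamma_unit conf).
exact: (lorentz_force_conformal_geodesic hK I_open gamma_smooth rE c1 lor).
Qed.
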